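(* Let $x,a,b$ be real numbers with $b>a>0$, let $c=b-a$, and suppose $x\ge 40\,c^{-5}(1+b)^{27/2}$. Then $$\sum_{n\ge 0}\big|\{x/(n+a)\}-\{x/(n+b)\}\big|=\frac{2}{\pi}\,\zeta(3/2)\sqrt{cx}+O\big(c^{2/9}x^{4/9}\big),$$ where the sum is over integers $n\ge 0$ and the implied constant is absolute.
   Context: $\{t\}=t-\lfloor t\rfloor$ is the fractional part of the real number $t$, and $\zeta$ is the Riemann zeta function. *)

(* Defs.v *)
(* Classical real numbers of Stdlib, with Coquelicot's series. *)
From Stdlib Require Import Reals.
From Coquelicot Require Import Coquelicot.
Open Scope R_scope.

(* The Riemann zeta function at a real argument s > 1, by its Dirichlet
   series 1 + 2^-s + 3^-s + ...; [Series] is meaningless for s <= 1. *)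
Definition zeta (s : R) : R := Series (fun n : nat => / Rpower (INR (S n)) s).

(* [frac_part t] is [t - IZR (Int_part t)], and [Int_part] is the floor
   (rounding towards minus infinity). *)
Definition frac_gap (x a b : R) (n : nat) : R :=
  Rabs (frac_part (x / (INR n + a)) - frac_part (x / (INR n + b))).

(* Main.v *)
Require Import Defs.
From Stdlib Require Import Reals.
From Coquelicot Require Import Coquelicot.
From Stdlib Require Import Lra Lia Psatz ZArith.
Open Scope R_scope.

(** Write [f n = x / (n + a)], [g n = x / (n + b)], [h = f - g] and [phi v = 2 {v} (1 - {v})].
    Then [|{f} - {g}| = phi h + (1 - 2 {h}) ({g} - {f})] exactly, and the second term averages out.

    Error term.  For [n] in [[N, 2N]] put [Q = N x^(-1/3)].  By Dirichlet the slope [x / (n + a)^2] is within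
    [1 / (q Q)] of some [p / q] with [q <= Q]; on the block of length [q] starting at [n], both [f] and [g] stay
    within [O(1 / q)] of arithmetic progressions of difference [- p / q] and [h] moves by [O(1 / q)], so the block
    contributes [O(1)], unless the integer part of [h] changes.  The number of blocks is [O(x^(1/3) log Q)], since the
    slope is monotone and spends little time near fractions of small denominator.  Summing over dyadic ranges between
    [N0], of order [E = c^(2/9) x^(4/9)], and [N1], of order [(1 + c) x / E], gives [O(E)].  Below [N0] the bound is
    trivial, and beyond [N1] the sum telescopes because [f (n + r) <= g n] for an integer [r >= c].

    Main term.  The sum of [phi (h n)] is compared with the integral of [phi (c x / t^2)].  The Fourier series
    [phi v = sum of 2 (1 - cos (2 pi k v)) / (pi k)^2] turns this integral into Fresnel integrals, equal to
    [pi sqrt (k c x)], whence [zeta (3/2)]. *)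

(** [Q = N x^(-1/3)] is the longest block length that linear approximation allows: the curvature of
    [x / t] near [N] is about [x / N^3 = Q^(-3)], so over [q <= Q] steps the deviation from a line
    is about [q^2 / Q^3 <= 1 / q], the spacing of the multiples of [p / q] modulo 1. Over such a
    block [{f}] and [{g}] both sum to [q / 2 + O(1)], and the factor [1 - 2 {h}] is nearly constant.
    Dirichlet dictates the block lengths point after point, so the blocks cannot be listed in
    advance; a monotone potential counts them.

    The logarithm in the block count is relaxed to a fourth root. The cost [x^(1/3) Q^(1/4)] of a
    range then grows geometrically with [N], the last range dominates, and at [N1] the requirement
    is [(1 + c) x^2 <= E^5] up to constants. This is where the factor [c^(-5)] in the lower bound on
    [x] enters; since [2 / 5 < 4 / 9], there is room for the loss. Changes of the integer part of
    [h] cost at most [Q] each, hence [c x^(2/3) / N] per range, which is largest at [N0]. *)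

(** * Finite sums *)

Fixpoint Rsum (f : nat -> R) (n : nat) : R :=
  match n with O => 0 | S m => Rsum f m + f m end.

Lemma Rsum_ext f g n : (forall i, (i < n)%nat -> f i = g i) -> Rsum f n = Rsum g n.
Proof.
induction n as [|n IH]; intros H; simpl; [reflexivity|].
rewrite IH by (intros; apply H; lia). rewrite H by lia. reflexivity.
Qed.

Lemma Rsum_le f g n : (forall i, (i < n)%nat -> f i <= g i) -> Rsum f n <= Rsum g n.
Proof.
induction n as [|n IH]; intros H; simpl; [lra|].
assert (f n <= g n) by (apply H; lia).
assert (Rsum f n <= Rsum g n) by (apply IH; intros; apply H; lia). lra.
Qed.

Lemma Rsum_plus f g n : Rsum (fun i => f i + g i) n = Rsum f n + Rsum g n.
Proof. induction n as [|n IH]; simpl; [lra | rewrite IH; lra]. Qed.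

Lemma Rsum_minus f g n : Rsum (fun i => f i - g i) n = Rsum f n - Rsum g n.
Proof. induction n as [|n IH]; simpl; [lra | rewrite IH; lra]. Qed.

Lemma Rsum_scal k f n : Rsum (fun i => k * f i) n = k * Rsum f n.
Proof. induction n as [|n IH]; simpl; [lra | rewrite IH; lra]. Qed.

Lemma Rsum_const k n : Rsum (fun _ => k) n = INR n * k.
Proof. induction n as [|n IH]; simpl Rsum; [simpl; lra | rewrite IH, S_INR; lra]. Qed.

Lemma Rsum_nonneg f n : (forall i, (i < n)%nat -> 0 <= f i) -> 0 <= Rsum f n.
Proof.
intros H. replace 0 with (Rsum (fun _ => 0) n) by (rewrite Rsum_const; lra).
now apply Rsum_le.
Qed.

Lemma Rsum_abs f n : Rabs (Rsum f n) <= Rsum (fun i => Rabs (f i)) n.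
Proof.
induction n as [|n IH]; simpl; [rewrite Rabs_R0; lra|].
eapply Rle_trans; [apply Rabs_triang|]. lra.
Qed.

Lemma Rsum_abs_le f g n : (forall i, (i < n)%nat -> Rabs (f i) <= g i) -> Rabs (Rsum f n) <= Rsum g n.
Proof. intros H. eapply Rle_trans; [apply Rsum_abs | now apply Rsum_le]. Qed.

Lemma Rsum_abs_const f k n : (forall i, (i < n)%nat -> Rabs (f i) <= k) -> Rabs (Rsum f n) <= INR n * k.
Proof. intros H. rewrite <- (Rsum_const k n). now apply Rsum_abs_le. Qed.

Lemma Rsum_add f n m : Rsum f (n + m) = Rsum f n + Rsum (fun i => f (n + i)%nat) m.
Proof.
induction m as [|m IH]; [rewrite Nat.add_0_r; simpl; lra|].
rewrite Nat.add_succ_r; simpl. rewrite IH; lra.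
Qed.

Lemma Rsum_swap (f : nat -> nat -> R) n m :
  Rsum (fun i => Rsum (fun j => f i j) m) n = Rsum (fun j => Rsum (fun i => f i j) n) m.
Proof.
induction n as [|n IH]; simpl; [rewrite Rsum_const; lra|].
rewrite IH, <- Rsum_plus. reflexivity.
Qed.

Lemma Rsum_INR n : Rsum INR n = INR n * (INR n - 1) / 2.
Proof. induction n as [|n IH]; simpl Rsum; [simpl; lra | rewrite IH, S_INR; field]. Qed.

Lemma Rsum_telescope u n : Rsum (fun i => u i - u (S i)) n = u 0%nat - u n.
Proof. induction n as [|n IH]; simpl; [lra | rewrite IH; lra]. Qed.

Lemma Rsum_sum_n f n : sum_n f n = Rsum f (S n).
Proof.
induction n as [|n IH]; [rewrite sum_O; simpl; lra|].
rewrite sum_Sn, IH. reflexivity.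
Qed.

(** A lag of [r] is a sum of [r] telescoping sums of lag 1, each at most [u 0]. It is applied with
    [r] an integer above a real shift such as [b - a] or [b]. *)
Lemma Rsum_telescope_lag u r n :
  (forall i, 0 <= u i) -> (forall i, u (S i) <= u i) ->
  Rsum (fun i => u i - u (i + r)%nat) n <= INR r * u 0%nat.
Proof.
intros Hp Hd. induction r as [|r IH].
- replace (Rsum _ n) with (Rsum (fun _ => 0) n); [rewrite Rsum_const; simpl; lra|].
  apply Rsum_ext; intros; rewrite Nat.add_0_r; lra.
- rewrite (Rsum_ext _ (fun i => (u i - u (i + r)%nat) + (u (i + r)%nat - u (S i + r)%nat))).
  2:{ intros; rewrite Nat.add_succ_r; simpl; lra. }
  rewrite Rsum_plus, (Rsum_telescope (fun i => u (i + r)%nat)), S_INR. simpl Nat.add.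
  assert (H : forall k, u k <= u 0%nat) by (induction k; [lra | eapply Rle_trans; eauto]).
  specialize (H r). specialize (Hp (n + r)%nat). lra.
Qed.

(** * Integer and fractional parts *)

Lemma Int_part_unique z r : IZR z <= r < IZR z + 1 -> Int_part r = z.
Proof.
intros [H1 H2]. destruct (base_Int_part r) as [H3 H4].
assert (IZR (Int_part r) < IZR z + 1) by lra.
assert (IZR z < IZR (Int_part r) + 1) by lra.
rewrite <- plus_IZR in *. apply lt_IZR in H, H0. lia.
Qed.

Lemma Int_part_le u v : u <= v -> IZR (Int_part u) <= IZR (Int_part v).
Proof.
intros H. destruct (base_Int_part u) as [H1 H2], (base_Int_part v) as [H3 H4].
apply IZR_le. assert (IZR (Int_part u) < IZR (Int_part v) + 1) by lra.
rewrite <- plus_IZR in *. apply lt_IZR in H0. lia.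
Qed.

Lemma frac_part_IZR r z : frac_part (r + IZR z) = frac_part r.
Proof.
unfold frac_part. rewrite (Int_part_unique (Int_part r + z) (r + IZR z)).
- rewrite plus_IZR; lra.
- destruct (base_Int_part r). rewrite plus_IZR; lra.
Qed.

Lemma frac_part_small r : 0 <= r < 1 -> frac_part r = r.
Proof. intros H. unfold frac_part. rewrite (Int_part_unique 0); simpl; lra. Qed.

(** The mean of [|{s} - {t}|] over all pairs with [s - t = v] fixed and [s] running over a period:
    the value is [{v}] on a proportion [1 - {v}] of the period, and [1 - {v}] on the rest. *)
Definition phi (v : R) : R := 2 * frac_part v * (1 - frac_part v).

(** [{u - v}] exceeds [{u} - {v}] by 0 or 1, according to the sign of the latter, and each case is a
    polynomial identity. *)
Lemma abs_frac_diff u v :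
  Rabs (frac_part u - frac_part v)
  = phi (u - v) + (1 - 2 * frac_part (u - v)) * (frac_part v - frac_part u).
Proof.
unfold phi. destruct (Rle_dec (frac_part v) (frac_part u)) as [H|H].
- rewrite Rminus_fp1 by lra. rewrite Rabs_right by lra. ring.
- rewrite Rminus_fp2 by lra. rewrite Rabs_left by lra. ring.
Qed.

(** * Fractional parts along an almost arithmetic progression *)

Lemma Rsum_periodic_shift w q s :
  (forall k, w (k + q)%nat = w k) -> Rsum (fun k => w (k + s)%nat) q = Rsum w q.
Proof.
intros Hw. induction s as [|s IH].
- apply Rsum_ext; intros; now rewrite Nat.add_0_r.
- rewrite <- IH. pose proof (Rsum_telescope (fun k => w (k + s)%nat) q) as H.
  rewrite Rsum_minus in H. simpl in H.
  rewrite (Rsum_ext (fun k => w (k + S s)%nat) (fun k => w (S (k + s)))) by (intros; f_equal; lia).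
  rewrite (Nat.add_comm q s), Hw in H. lra.
Qed.

Definition frac_prog (p : Z) (q : nat) (al : R) : R :=
  Rsum (fun k => frac_part (al - INR k * IZR p / INR q)) q.

(** Since [p] is invertible modulo [q], the translation by [1 / q] amounts, modulo 1, to a shift of
    the index [k], and the summand has period [q] in [k]. *)
Lemma frac_prog_shift p q al :
  (0 < q)%nat -> (exists s r : Z, s * p + r * Z.of_nat q = 1)%Z ->
  frac_prog p q (al + / INR q) = frac_prog p q al.
Proof.
intros Hq (s & r & Hb). assert (Hq' : 0 < INR q) by now apply lt_0_INR.
(* a nonnegative integer congruent to [- s] modulo [q] *)
set (t := Z.to_nat (- s + Z.abs s * Z.of_nat q)).
assert (Ht : Z.of_nat t = (- s + Z.abs s * Z.of_nat q)%Z).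
{ unfold t. rewrite Z2Nat.id; [reflexivity|]. nia. }
unfold frac_prog.
rewrite <- (Rsum_periodic_shift (fun k => frac_part (al - INR k * IZR p / INR q)) q t).
- apply Rsum_ext; intros k Hk.
  replace (al + / INR q - INR k * IZR p / INR q)
    with (al - INR (k + t) * IZR p / INR q + IZR (r + Z.abs s * p)).
  + now rewrite frac_part_IZR.
  + rewrite plus_INR, plus_IZR, mult_IZR.
    assert (Hb' : IZR s * IZR p + IZR r * INR q = 1).
    { rewrite (INR_IZR_INZ q), <- !mult_IZR, <- plus_IZR, Hb. reflexivity. }
    assert (Ht' : INR t = - IZR s + IZR (Z.abs s) * INR q).
    { rewrite (INR_IZR_INZ t), Ht, plus_IZR, opp_IZR, mult_IZR, <- INR_IZR_INZ. reflexivity. }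
    rewrite Ht'. apply (Rmult_eq_reg_r (INR q)); [|lra]. field_simplify; [|lra|lra].
    rewrite <- Hb'. ring.
- intros k. rewrite plus_INR.
  replace (al - (INR k + INR q) * IZR p / INR q) with (al - INR k * IZR p / INR q + IZR (- p)).
  + now rewrite frac_part_IZR.
  + rewrite opp_IZR. field. lra.
Qed.

Lemma frac_prog_shift_nat p q al j :
  (0 < q)%nat -> (exists s r : Z, s * p + r * Z.of_nat q = 1)%Z ->
  frac_prog p q (al + INR j / INR q) = frac_prog p q al.
Proof.
intros Hq Hb. assert (Hq' : 0 < INR q) by now apply lt_0_INR.
induction j as [|j IH].
- simpl. unfold Rdiv. now rewrite Rmult_0_l, Rplus_0_r.
- rewrite S_INR, <- IH, <- (frac_prog_shift p q (al + INR j / INR q)) by assumption.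
  f_equal. field. lra.
Qed.

(** Hermite's identity: the sum is [{q y} + (q - 1) / 2]. It is invariant under translation of [y]
    by [1 / q], so [y] may be moved into [[0, 1 / q)], where every argument lies in [[0, 1)]. *)
Lemma hermite_bounds q y : (0 < q)%nat ->
  (INR q - 1) / 2 <= Rsum (fun j => frac_part (y + INR j / INR q)) q <= (INR q + 1) / 2.
Proof.
intros Hq. assert (Hq' : 0 < INR q) by now apply lt_0_INR.
set (H := fun y => Rsum (fun j => frac_part (y + INR j / INR q)) q).
assert (Hs : forall y, H (y + / INR q) = H y).
{ intros z. unfold H.
  rewrite <- (Rsum_periodic_shift (fun j => frac_part (z + INR j / INR q)) q 1).
  - apply Rsum_ext; intros k _. f_equal. rewrite plus_INR; simpl. field; lra.
  - intros k. rewrite plus_INR. replace (z + (INR k + INR q) / INR q) with (z + INR k / INR q + IZR 1).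
    + now rewrite frac_part_IZR.
    + simpl. field; lra. }
assert (Hn : forall j y, H (y + INR j / INR q) = H y).
{ induction j as [|j IH]; intros z.
  - simpl. unfold Rdiv. now rewrite Rmult_0_l, Rplus_0_r.
  - rewrite S_INR, <- (IH z), <- (Hs (z + INR j / INR q)). f_equal. field; lra. }
assert (Hz : forall m y, H (y + IZR m / INR q) = H y).
{ intros m z. destruct (Z_le_dec 0 m).
  - rewrite <- (Z2Nat.id m) by lia. rewrite <- INR_IZR_INZ. apply Hn.
  - rewrite <- (Hn (Z.to_nat (- m)) (z + _)). f_equal.
    rewrite (INR_IZR_INZ (Z.to_nat (- m))), Z2Nat.id, opp_IZR by lia. field; lra. }
change (Rsum _ q) with (H y).
set (m := Int_part (INR q * y)). set (y0 := y - IZR m / INR q).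
assert (Hy0 : 0 <= INR q * y0 < 1).
{ unfold y0. destruct (base_Int_part (INR q * y)) as [H1 H2]. fold m in H1, H2.
  replace (INR q * (y - IZR m / INR q)) with (INR q * y - IZR m) by (field; lra). lra. }
replace (H y) with (H y0).
2:{ rewrite <- (Hz m y0). f_equal. unfold y0; ring. }
assert (E : H y0 = INR q * y0 + (INR q - 1) / 2).
{ unfold H. rewrite (Rsum_ext _ (fun j => y0 + / INR q * INR j)).
  - rewrite Rsum_plus, Rsum_const, Rsum_scal, Rsum_INR. field. lra.
  - intros j Hj. rewrite frac_part_small; [unfold Rdiv; ring|].
    assert (Hj' : INR j + 1 <= INR q) by (rewrite <- S_INR; apply le_INR; lia).
    assert (0 <= INR j) by apply pos_INR.
    split; apply (Rmult_le_reg_l (INR q)) || apply (Rmult_lt_reg_l (INR q)); try lra;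
      replace (INR q * (y0 + INR j / INR q)) with (INR q * y0 + INR j) by (field; lra); lra. }
rewrite E. lra.
Qed.

Lemma frac_prog_bounds p q al :
  (0 < q)%nat -> (exists s r : Z, s * p + r * Z.of_nat q = 1)%Z ->
  (INR q - 1) / 2 <= frac_prog p q al <= (INR q + 1) / 2.
Proof.
intros Hq Hb. assert (Hq' : 0 < INR q) by now apply lt_0_INR.
(* [frac_prog] equals its average over the shifts by [j / q], and each inner sum is then of Hermite type. *)
assert (E : INR q * frac_prog p q al
  = Rsum (fun k => Rsum (fun j => frac_part ((al - INR k * IZR p / INR q) + INR j / INR q)) q) q).
{ rewrite <- Rsum_const, Rsum_swap. apply Rsum_ext; intros j _.
  rewrite <- (frac_prog_shift_nat p q al j) by assumption.
  unfold frac_prog. apply Rsum_ext; intros; f_equal; ring. }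
assert (H1 : INR q * ((INR q - 1) / 2) <= INR q * frac_prog p q al).
{ rewrite E, <- Rsum_const. apply Rsum_le; intros. now apply hermite_bounds. }
assert (H2 : INR q * frac_prog p q al <= INR q * ((INR q + 1) / 2)).
{ rewrite E, <- Rsum_const. apply Rsum_le; intros. now apply hermite_bounds. }
split; eapply Rmult_le_reg_l; eauto.
Qed.

(** The fractional part is not monotone, but the integer part is: the sum of the integer parts of
    [u] is squeezed between those of the progression moved by [K / q] either way. One [K] comes from
    this move, the other from replacing the sum of [u] by that of the progression, and [1 / 2] from
    [frac_prog_bounds]. *)
Lemma frac_sum_near_progression p q al K (u : nat -> R) :
  (0 < q)%nat -> (exists s r : Z, s * p + r * Z.of_nat q = 1)%Z ->
  (forall k, (k < q)%nat -> Rabs (u k - (al - INR k * IZR p / INR q)) <= K / INR q) ->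
  Rabs (Rsum (fun k => frac_part (u k)) q - INR q / 2) <= 2 * K + 1 / 2.
Proof.
intros Hq Hb Hu. assert (Hq' : 0 < INR q) by now apply lt_0_INR.
set (v := fun k => al - INR k * IZR p / INR q).
assert (Hdev : Rabs (Rsum u q - Rsum v q) <= K).
{ rewrite <- Rsum_minus. replace K with (INR q * (K / INR q)) by (field; lra).
  apply Rsum_abs_const. exact Hu. }
assert (Hfl : forall d, Rsum (fun k => IZR (Int_part (v k + d))) q
   = Rsum v q + INR q * d - frac_prog p q (al + d)).
{ intros d. unfold frac_prog. rewrite <- Rsum_const, <- Rsum_plus, <- Rsum_minus.
  apply Rsum_ext; intros k _. unfold frac_part, v.
  replace (al + d - INR k * IZR p / INR q) with (al - INR k * IZR p / INR q + d) by ring. ring. }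
assert (Hup : Rsum (fun k => IZR (Int_part (u k))) q <= Rsum (fun k => IZR (Int_part (v k + K / INR q))) q).
{ apply Rsum_le; intros k Hk. apply Int_part_le. specialize (Hu k Hk).
  apply Rabs_le_between in Hu. unfold v; lra. }
assert (Hlo : Rsum (fun k => IZR (Int_part (v k + - (K / INR q)))) q <= Rsum (fun k => IZR (Int_part (u k))) q).
{ apply Rsum_le; intros k Hk. apply Int_part_le. specialize (Hu k Hk).
  apply Rabs_le_between in Hu. unfold v; lra. }
rewrite Hfl in Hup, Hlo.
replace (INR q * (K / INR q)) with K in Hup by (field; lra).
replace (INR q * - (K / INR q)) with (- K) in Hlo by (field; lra).
pose proof (frac_prog_bounds p q (al + K / INR q) Hq Hb) as B1.
pose proof (frac_prog_bounds p q (al + - (K / INR q)) Hq Hb) as B2.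
assert (E : Rsum (fun k => frac_part (u k)) q = Rsum u q - Rsum (fun k => IZR (Int_part (u k))) q).
{ rewrite <- Rsum_minus. apply Rsum_ext; intros; reflexivity. }
rewrite E. apply Rabs_le_between in Hdev. apply Rabs_le_between. lra.
Qed.

(** * Rational approximation *)

(** Neighbours of [be] in the Farey sequence of order [M]. Passing to the next order inserts the
    mediant exactly when its denominator [q + q'] does not exceed the new order. *)
Lemma farey_neighbours (be : R) (M : nat) : (1 <= M)%nat ->
  exists p p' q q' : Z, (1 <= q <= Z.of_nat M /\ 1 <= q' <= Z.of_nat M /\ q + q' >= Z.of_nat M + 1
    /\ p' * q - p * q' = 1)%Z /\ 0 <= IZR q * be - IZR p /\ 0 <= IZR p' - IZR q' * be.
Proof.
intros HM. induction M as [|M IH]; [lia|].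
destruct M as [|M].
- exists (Int_part be), (Int_part be + 1)%Z, 1%Z, 1%Z.
  destruct (base_Int_part be). rewrite plus_IZR. repeat split; try lia; lra.
- destruct IH as (p & p' & q & q' & (H1 & H2 & H3 & H4) & H5 & H6); [lia|].
  destruct (Z_ge_dec (q + q') (Z.of_nat (S (S M)) + 1)) as [Hge|Hlt].
  + exists p, p', q, q'. repeat split; try lia; assumption.
  + destruct (Rle_dec 0 (IZR (q + q') * be - IZR (p + p'))) as [Hm|Hm].
    * exists (p + p')%Z, p', (q + q')%Z, q'. repeat split; try lia; assumption.
    * exists p, (p + p')%Z, q, (q + q')%Z. repeat split; try lia; lra.
Qed.

(** With [A] and [A'] the two defects, [q' A + q A' = 1] and [q + q' >= M + 1], so they cannot both
    exceed [1 / (M + 1)]. The determinant of the Farey pair supplies the Bezout relation, which a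
    pigeonhole argument would not give directly. *)
Lemma dirichlet_approx (be : R) (M : nat) : (1 <= M)%nat ->
  exists (p : Z) (q : nat), (1 <= q <= M)%nat /\ (exists s r : Z, s * p + r * Z.of_nat q = 1)%Z
    /\ Rabs (INR q * be - IZR p) <= / (INR M + 1).
Proof.
intros HM. destruct (farey_neighbours be M HM) as (p & p' & q & q' & (H1 & H2 & H3 & H4) & H5 & H6).
set (A := IZR q * be - IZR p) in *. set (A' := IZR p' - IZR q' * be) in *.
assert (Hid : IZR q' * A + IZR q * A' = 1).
{ unfold A, A'. transitivity (IZR p' * IZR q - IZR p * IZR q'); [ring|].
  rewrite <- !mult_IZR, <- minus_IZR, H4. reflexivity. }
assert (Hs : INR M + 1 <= IZR q + IZR q').
{ rewrite INR_IZR_INZ, <- !plus_IZR. apply IZR_le. lia. }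
assert (Hq : 0 < IZR q) by (apply IZR_lt; lia). assert (Hq' : 0 < IZR q') by (apply IZR_lt; lia).
assert (HM' : 0 < INR M + 1) by (pose proof (pos_INR M); lra).
destruct (Rle_dec A (/ (INR M + 1))) as [HA|HA].
- exists p, (Z.to_nat q). rewrite (INR_IZR_INZ (Z.to_nat _)), Z2Nat.id by lia. repeat split; try lia.
  + exists (- q')%Z, p'. lia.
  + fold A. rewrite Rabs_right; lra.
- exists p', (Z.to_nat q'). rewrite (INR_IZR_INZ (Z.to_nat _)), Z2Nat.id by lia. repeat split; try lia.
  + exists q, (- p)%Z. lia.
  + rewrite Rabs_minus_sym. fold A'. rewrite Rabs_right by lra.
    destruct (Rle_dec A' (/ (INR M + 1))) as [HA'|HA']; [assumption|exfalso].
    assert (1 < (INR M + 1) * A). { apply Rnot_le_lt in HA. apply (Rmult_lt_compat_l (INR M + 1)) in HA; [|lra]. rewrite Rinv_r in HA by lra. exact HA. }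
    assert (1 < (INR M + 1) * A'). { apply Rnot_le_lt in HA'. apply (Rmult_lt_compat_l (INR M + 1)) in HA'; [|lra]. rewrite Rinv_r in HA' by lra. exact HA'. }
    nra.
Qed.

(** * The measure of the points close to an integer *)

Lemma frac_part_bounds r : 0 <= frac_part r < 1.
Proof. destruct (base_fp r); lra. Qed.

Lemma Rsum_ge_term f n i : (i < n)%nat -> (forall j, (j < n)%nat -> 0 <= f j) -> f i <= Rsum f n.
Proof.
induction n as [|n IH]; intros Hi Hf; [lia|]. simpl.
destruct (Nat.eq_dec i n) as [->|Hne].
- assert (0 <= Rsum f n) by (apply Rsum_nonneg; intros; apply Hf; lia). lra.
- assert (f i <= Rsum f n) by (apply IH; [lia | intros; apply Hf; lia]).
  assert (0 <= f n) by (apply Hf; lia). lra.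
Qed.

(* Up to an additive constant, the measure of the points of [(-oo, y]] lying within [eta] of an integer. *)
Definition near_int_measure (eta y : R) : R :=
  2 * eta * IZR (Int_part (y + eta)) + Rmin (frac_part (y + eta)) (2 * eta).

Lemma near_int_measure_le eta y y' : 0 < eta ->
  y' <= y -> near_int_measure eta y' <= near_int_measure eta y.
Proof.
intros He Hy. unfold near_int_measure.
assert (H : y' + eta <= y + eta) by lra. apply Int_part_le in H.
pose proof (frac_part_bounds (y + eta)). pose proof (frac_part_bounds (y' + eta)).
destruct (Z.eq_dec (Int_part (y' + eta)) (Int_part (y + eta))) as [E|E].
- assert (frac_part (y' + eta) <= frac_part (y + eta)) by (unfold frac_part; rewrite E; lra).
  rewrite E. apply Rplus_le_compat_l. unfold Rmin; repeat destruct Rle_dec; lra.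
- assert (IZR (Int_part (y' + eta)) + 1 <= IZR (Int_part (y + eta))).
  { rewrite <- plus_IZR. apply IZR_le. apply le_IZR in H. lia. }
  assert (Rmin (frac_part (y' + eta)) (2 * eta) <= 2 * eta) by apply Rmin_r.
  assert (0 <= Rmin (frac_part (y + eta)) (2 * eta)) by (apply Rmin_glb; lra).
  nra.
Qed.

Lemma near_int_measure_window eta (p : Z) y y' : 0 < eta < 1 / 2 ->
  IZR p - eta <= y' -> y' <= y -> y <= IZR p + eta ->
  near_int_measure eta y - near_int_measure eta y' = y - y'.
Proof.
intros He H1 H2 H3. unfold near_int_measure, frac_part.
rewrite (Int_part_unique p (y + eta)), (Int_part_unique p (y' + eta)) by lra.
rewrite !Rmin_left by lra. ring.
Qed.

(** From [eta] on, the window around 0 is already counted in full, and this offsets a possibly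
    incomplete last window. What remains is [2 eta] for each of at most [y + eta <= 2 y] windows. *)
Lemma near_int_measure_diff_le eta y y' : 0 < eta < 1 / 2 -> eta <= y' -> y' <= y ->
  near_int_measure eta y - near_int_measure eta y' <= 4 * eta * y.
Proof.
intros He H1 H2.
assert (Hlo : 2 * eta <= near_int_measure eta y').
{ replace (2 * eta) with (near_int_measure eta eta); [apply near_int_measure_le; lra|].
  unfold near_int_measure, frac_part. rewrite (Int_part_unique 0) by lra. rewrite Rmin_right; lra. }
unfold near_int_measure at 1.
assert (Rmin (frac_part (y + eta)) (2 * eta) <= 2 * eta) by apply Rmin_r.
destruct (base_Int_part (y + eta)).
nra.
Qed.

(** * Errors on blocks and dyadic ranges *)

Definition err (x a b : R) (n : nat) : R :=
  (1 - 2 * frac_part (x / (INR n + a) - x / (INR n + b)))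
  * (frac_part (x / (INR n + b)) - frac_part (x / (INR n + a))).

Lemma err_abs_le x a b n : Rabs (err x a b n) <= 1.
Proof.
unfold err. rewrite Rabs_mult.
pose proof (frac_part_bounds (x / (INR n + a) - x / (INR n + b))).
pose proof (frac_part_bounds (x / (INR n + a))). pose proof (frac_part_bounds (x / (INR n + b))).
rewrite <- (Rmult_1_l 1). apply Rmult_le_compat; try apply Rabs_pos; apply Rabs_le; lra.
Qed.

(** Factored so that the last quotient is at most 2, which leaves a bound of order [x c k / y^3]. *)
Lemma gap_decrease x c y k : 0 < x -> 0 < y -> 0 <= c -> 0 <= k ->
  (x / y - x / (y + c)) - (x / (y + k) - x / (y + k + c))
  = (x * c * k / (y * (y + c) * (y + k))) * ((2 * y + c + k) / (y + k + c)).
Proof. intros. field. repeat split; lra. Qed.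

Lemma gap_antitone x a b n k : 0 < x -> 0 < a -> a <= b ->
  x / (INR (n + k) + a) - x / (INR (n + k) + b) <= x / (INR n + a) - x / (INR n + b).
Proof.
intros Hx Ha Hb. pose proof (pos_INR n) as Hn. pose proof (pos_INR k) as Hk.
pose proof (gap_decrease x (b - a) (INR n + a) (INR k) Hx ltac:(lra) ltac:(lra) Hk) as E.
rewrite plus_INR.
replace (INR n + INR k + a) with (INR n + a + INR k) by ring.
replace (INR n + INR k + b) with (INR n + a + INR k + (b - a)) by ring.
replace (INR n + b) with (INR n + a + (b - a)) by ring.
enough (0 <= x * (b - a) * INR k / ((INR n + a) * (INR n + a + (b - a)) * (INR n + a + INR k)) * ((2 * (INR n + a) + (b - a) + INR k) / (INR n + a + INR k + (b - a)))) by lra.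
apply Rmult_le_pos; apply Rdiv_le_0_compat; try (repeat apply Rmult_le_pos; lra); try lra.
repeat apply Rmult_lt_0_compat; lra.
Qed.

(** [Q ^ 3 * x = N ^ 3] makes every second-order effect along the block at most a constant over [q],
    so [frac_sum_near_progression] applies to both sequences with the same [p] and [q], and their
    means cancel. If the integer part of the gap changes, [{h}] may jump; the trivial bound [q <= Q]
    is then charged to that drop. *)
Lemma block_error x a b N Q n (p : Z) (q : nat) :
  0 < x -> 0 < a -> a <= b -> 0 < N -> Q ^ 3 * x = N ^ 3 -> N <= INR n -> b - a <= Q ->
  (1 <= q)%nat -> INR q <= Q -> (exists s r : Z, s * p + r * Z.of_nat q = 1)%Z ->
  Rabs (INR q * (x / (INR n + a) ^ 2) - IZR p) <= / Q ->
  Rabs (Rsum (fun k => err x a b (n + k)) q)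
  <= 17 + Q * (IZR (Int_part (x / (INR n + a) - x / (INR n + b)))
               - IZR (Int_part (x / (INR (n + q) + a) - x / (INR (n + q) + b)))).
Proof.
intros Hx Ha Hb HN HQ Hn Hc Hq HqQ Hbez Hdir.
assert (Hq1 : 1 <= INR q) by (change 1 with (INR 1); now apply le_INR).
set (h := fun k => x / (INR (n + k) + a) - x / (INR (n + k) + b)).
set (y := INR n + a) in *.
assert (Hy : N <= y) by (unfold y; lra).
assert (HyN : N ^ 3 <= y ^ 3) by (apply pow_incr; lra).
assert (Hh : forall k, (k < q)%nat -> 0 <= h 0%nat - h k <= 2 / INR q).
{ intros k Hk. split.
  - pose proof (gap_antitone x a b n k Hx Ha Hb) as H. unfold h. rewrite Nat.add_0_r. lra.
  - assert (HkR : INR k <= INR q) by (apply le_INR; lia). pose proof (pos_INR k) as Hk0.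
    pose proof (gap_decrease x (b - a) y (INR k) Hx ltac:(lra) ltac:(lra) Hk0) as E.
    unfold h. rewrite Nat.add_0_r, plus_INR. fold y.
    replace (INR n + INR k + a) with (y + INR k) by (unfold y; ring).
    replace (INR n + INR k + b) with (y + INR k + (b - a)) by (unfold y; ring).
    replace (INR n + b) with (y + (b - a)) by (unfold y; ring).
    rewrite E. replace (2 / INR q) with (/ INR q * 2) by (field; lra).
    apply Rmult_le_compat.
    + apply Rdiv_le_0_compat; [repeat apply Rmult_le_pos | repeat apply Rmult_lt_0_compat]; lra.
    + apply Rdiv_le_0_compat; lra.
    + apply Rle_div_l; [repeat apply Rmult_lt_0_compat; lra|].
      rewrite (Rmult_comm (/ INR q)). apply (proj1 (Rle_div_r _ _ (INR q) ltac:(lra))).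
      apply Rle_trans with (x * Q * Q * Q).
      * apply Rmult_le_compat; try lra; repeat apply Rmult_le_pos; try lra.
        apply Rmult_le_compat; try lra; repeat apply Rmult_le_pos; try lra.
        apply Rmult_le_compat_l; lra.
      * replace (x * Q * Q * Q) with (Q ^ 3 * x) by ring. rewrite HQ.
        apply Rle_trans with (y * y * y); [simpl in HyN; lra|].
        repeat apply Rmult_le_compat; try apply Rmult_le_pos; lra.
    + apply Rle_div_l; lra. }
(* Exact first-order expansion: the Dirichlet defect times [k / q], plus the remainder
   [x k^2 / (y^2 (y + k))]. Each is at most [1 / q], the second because [x q^3 <= x Q^3 = N^3]. *)
assert (Hf : forall k, (k < q)%nat ->
  Rabs (x / (INR (n + k) + a) - (x / y - INR k * IZR p / INR q)) <= 2 / INR q).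
{ intros k Hk. assert (HkR : INR k <= INR q) by (apply le_INR; lia). pose proof (pos_INR k) as Hk0.
  rewrite plus_INR. replace (INR n + INR k + a) with (y + INR k) by (unfold y; ring).
  replace (x / (y + INR k) - (x / y - INR k * IZR p / INR q))
    with (- (INR k / INR q * (INR q * (x / y ^ 2) - IZR p)) + x * INR k ^ 2 / (y ^ 2 * (y + INR k)))
    by (field; repeat split; lra).
  eapply Rle_trans; [apply Rabs_triang|]. rewrite Rabs_Ropp, Rabs_mult.
  replace (2 / INR q) with (/ INR q + / INR q) by (field; lra).
  apply Rplus_le_compat.
  - rewrite <- (Rmult_1_l (/ INR q)).
    apply Rmult_le_compat; try apply Rabs_pos.
    + rewrite Rabs_right; [apply Rle_div_l; lra | apply Rle_ge, Rdiv_le_0_compat; lra].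
    + eapply Rle_trans; [exact Hdir|]. apply Rinv_le_contravar; lra.
  - rewrite Rabs_right.
    2:{ apply Rle_ge, Rdiv_le_0_compat; [|apply Rmult_lt_0_compat; [apply pow_lt|]; lra].
        apply Rmult_le_pos; [lra | apply pow_le; lra]. }
    apply Rle_div_l; [apply Rmult_lt_0_compat; [apply pow_lt|]; lra|].
    rewrite (Rmult_comm (/ INR q)). apply (proj1 (Rle_div_r _ _ (INR q) ltac:(lra))).
    apply Rle_trans with (x * Q ^ 2 * Q).
    + apply Rmult_le_compat; try lra; [apply Rmult_le_pos; [lra | apply pow_le; lra]|].
      apply Rmult_le_compat_l; [lra|]. apply pow_incr; lra.
    + replace (x * Q ^ 2 * Q) with (Q ^ 3 * x) by ring. rewrite HQ.
      apply Rle_trans with (y ^ 3); [exact HyN|].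
      replace (y ^ 3) with (y ^ 2 * y) by ring. apply Rmult_le_compat_l; [apply pow_le|]; lra. }
(* The second sequence is the first minus the gap, so its deviation is at most [2 / q] from [Hf]
   plus [2 / q] from [Hh]. *)
assert (Hg : forall k, (k < q)%nat ->
  Rabs (x / (INR (n + k) + b) - (x / (INR n + b) - INR k * IZR p / INR q)) <= 4 / INR q).
{ intros k Hk. specialize (Hf k Hk). specialize (Hh k Hk). unfold h in Hh.
  rewrite Nat.add_0_r in Hh. fold y in Hh.
  apply Rabs_le_between in Hf. apply Rabs_le_between. unfold Rdiv in *. lra. }
assert (SF := frac_sum_near_progression p q _ 2 _ Hq Hbez Hf).
assert (SG := frac_sum_near_progression p q _ 4 _ Hq Hbez Hg).
simpl in SF, SG.
set (F := fun k => frac_part (x / (INR (n + k) + a))) in *.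
set (G := fun k => frac_part (x / (INR (n + k) + b))) in *.
assert (Hmono : h q <= h 0%nat).
{ unfold h. rewrite Nat.add_0_r. now apply gap_antitone. }
change (x / y - x / (INR n + b)) with (x / (INR n + a) - x / (INR n + b)).
replace (x / (INR n + a) - x / (INR n + b)) with (h 0%nat) by (unfold h; now rewrite Nat.add_0_r).
change (x / (INR (n + q) + a) - x / (INR (n + q) + b)) with (h q).
destruct (Z.eq_dec (Int_part (h 0%nat)) (Int_part (h q))) as [E|E].
- rewrite <- E, Rminus_diag, Rmult_0_r, Rplus_0_r.
  set (th := frac_part (h 0%nat)).
  assert (Hth : 0 <= th < 1) by apply frac_part_bounds.
  rewrite (Rsum_ext _ (fun k => (1 - 2 * th) * (G k - F k) + 2 * (th - frac_part (h k)) * (G k - F k)))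
    by (intros; unfold err, F, G, h; ring).
  rewrite Rsum_plus, Rsum_scal, Rsum_minus.
  eapply Rle_trans; [apply Rabs_triang|].
  (* 13 is [(2 * 2 + 1 / 2) + (2 * 4 + 1 / 2)], from the sums of [F] and [G]; 4 is the cost of
     freezing [frac_part (h k)] at [th], namely [4 / q] per term. *)
  replace 17 with (13 + 4) by ring. apply Rplus_le_compat.
  + rewrite Rabs_mult. rewrite <- (Rmult_1_l 13). apply Rmult_le_compat; try apply Rabs_pos.
    * apply Rabs_le; lra.
    * apply Rabs_le_between in SF. apply Rabs_le_between in SG. apply Rabs_le; lra.
  + replace 4 with (INR q * (4 / INR q)) by (field; lra).
    apply Rsum_abs_const. intros k Hk.
    assert (Ek : Int_part (h k) = Int_part (h 0%nat)).
    { assert (h q <= h k).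
      { unfold h. replace (n + q)%nat with (n + k + (q - k))%nat by lia. now apply gap_antitone. }
      assert (H1 := Int_part_le _ _ H). assert (h k <= h 0%nat) by (specialize (Hh k Hk); lra).
      assert (H2 := Int_part_le _ _ H0). apply le_IZR in H1, H2. lia. }
    rewrite Rabs_mult. rewrite <- (Rmult_1_r (4 / INR q)). apply Rmult_le_compat; try apply Rabs_pos.
    * specialize (Hh k Hk). unfold th, frac_part. rewrite Ek.
      apply Rabs_le. unfold Rdiv in *. lra.
    * pose proof (frac_part_bounds (x / (INR (n + k) + a))). pose proof (frac_part_bounds (x / (INR (n + k) + b))).
      unfold F, G. apply Rabs_le; lra.
(* The integer part drops by at least 1 here, so [Q] times the drop covers all [q] terms. *)
- apply Int_part_le in Hmono.
  assert (1 <= IZR (Int_part (h 0%nat)) - IZR (Int_part (h q))).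
  { rewrite <- minus_IZR. apply IZR_le. apply le_IZR in Hmono. lia. }
  eapply Rle_trans; [apply Rsum_abs_const; intros; apply err_abs_le|]. nra.
Qed.

(* Every block of length [q] lowers the potential by at least 1, so its total drop bounds the number of blocks. *)
Definition potential (x a Q : R) (m n : nat) : R :=
  Rsum (fun i => 27 * Q ^ 3 / INR (S i) ^ 2
    * near_int_measure (3 / Q) (INR (S i) * (x / (INR n + a) ^ 2))) m.

Lemma slope_antitone x a n k : 0 < x -> 0 < a ->
  x / (INR (n + k) + a) ^ 2 <= x / (INR n + a) ^ 2.
Proof.
intros Hx Ha. pose proof (pos_INR n). pose proof (pos_INR k).
apply Rmult_le_compat_l; [lra|]. apply Rinv_le_contravar; [apply pow_lt; lra|].
apply pow_incr. rewrite plus_INR. lra.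
Qed.

(** Only the term with denominator [q] is needed, all others being nonnegative. There [q] times the
    slope starts within [1 / Q] of [p] and falls by at most [2 / Q], so it stays in the window of
    radius [3 / Q], where the measure has slope 1. It falls by at least [q^2 / (27 Q^3)], with
    [27 = 3^3] coming from the upper end [3 N] of the range; the weight in [potential] is the
    inverse of this. *)
Lemma potential_drop x a N Q m n (p : Z) (q : nat) :
  0 < x -> 0 < a -> 0 < N -> 8 <= Q -> Q ^ 3 * x = N ^ 3 -> N <= INR n -> INR n + a + INR q <= 3 * N ->
  (1 <= q <= m)%nat -> INR q <= Q ->
  Rabs (INR q * (x / (INR n + a) ^ 2) - IZR p) <= / Q ->
  1 <= potential x a Q m n - potential x a Q m (n + q).
Proof.
intros Hx Ha HN HQ8 HQ Hn Hn3 Hq HqQ Hdir.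
assert (Hq1 : 1 <= INR q) by (change 1 with (INR 1); apply le_INR; lia).
unfold potential. rewrite <- Rsum_minus.
refine (Rle_trans _ _ _ _ (Rsum_ge_term _ m (q - 1) _ _)); [|lia|].
- cbv beta. replace (S (q - 1)) with q by lia. rewrite <- Rmult_minus_distr_l.
  set (y := INR n + a) in *. assert (Hy : N <= y) by (unfold y; lra).
  rewrite plus_INR. replace (INR n + INR q + a) with (y + INR q) by (unfold y; ring).
  assert (HD : INR q * (x / y ^ 2) - INR q * (x / (y + INR q) ^ 2)
     = x * INR q ^ 2 * (2 * y + INR q) / (y ^ 2 * (y + INR q) ^ 2)) by (field; lra).
  assert (Hden : 0 < y ^ 2 * (y + INR q) ^ 2) by (apply Rmult_lt_0_compat; apply pow_lt; lra).
  assert (Hlo : INR q ^ 2 / (27 * Q ^ 3) <= INR q * (x / y ^ 2) - INR q * (x / (y + INR q) ^ 2)).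
  { rewrite HD. assert (0 < Q ^ 3) by (apply pow_lt; lra).
    apply (proj1 (Rle_div_r _ _ _ Hden)). rewrite Rmult_comm. unfold Rdiv. rewrite <- Rmult_assoc.
    apply Rle_div_l; [lra|].
    replace (x * INR q ^ 2 * (2 * y + INR q) * (27 * Q ^ 3)) with (INR q ^ 2 * ((3 * N) ^ 3 * (2 * y + INR q)))
      by (replace ((3 * N) ^ 3) with (27 * N ^ 3) by ring; rewrite <- HQ; ring).
    rewrite Rmult_comm. apply Rmult_le_compat_l; [apply pow_le; lra|].
    apply Rle_trans with ((y + INR q) ^ 3 * (2 * y + INR q)).
    - replace ((y + INR q) ^ 3 * (2 * y + INR q)) with (((y + INR q) * (2 * y + INR q)) * (y + INR q) ^ 2) by ring.
      apply Rmult_le_compat_r; [apply pow_le; lra|]. nra.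
    - apply Rmult_le_compat_r; [lra|]. apply pow_incr. lra. }
  assert (Hup : INR q * (x / y ^ 2) - INR q * (x / (y + INR q) ^ 2) <= 2 / Q).
  { rewrite HD. apply Rle_div_l; [exact Hden|].
    replace (2 / Q * (y ^ 2 * (y + INR q) ^ 2)) with (2 * (y ^ 2 * (y + INR q) ^ 2) / Q) by (field; lra).
    apply (proj1 (Rle_div_r _ _ Q ltac:(lra))).
    apply Rle_trans with (N ^ 3 * (2 * y + INR q)).
    - rewrite <- HQ. replace (x * INR q ^ 2 * (2 * y + INR q) * Q) with ((INR q ^ 2 * Q) * (x * (2 * y + INR q))) by ring.
      replace (Q ^ 3 * x * (2 * y + INR q)) with ((Q ^ 2 * Q) * (x * (2 * y + INR q))) by ring.
      apply Rmult_le_compat_r; [nra|]. apply Rmult_le_compat_r; [lra|]. apply pow_incr; lra.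
    - apply Rle_trans with (y ^ 3 * (2 * (y + INR q))).
      + apply Rmult_le_compat; [apply pow_le; lra | lra | apply pow_incr; lra | lra].
      + replace (y ^ 3 * (2 * (y + INR q))) with ((2 * y ^ 2 * (y + INR q)) * y) by ring.
        replace (2 * (y ^ 2 * (y + INR q) ^ 2)) with ((2 * y ^ 2 * (y + INR q)) * (y + INR q)) by ring.
        apply Rmult_le_compat_l; [|lra]. assert (0 <= y ^ 2) by (apply pow_le; lra). nra. }
  assert (H3Q : 3 / Q < 1 / 2) by (apply Rlt_div_l; lra).
  assert (HQi : 0 < / Q) by (apply Rinv_0_lt_compat; lra).
  apply Rabs_le_between in Hdir.
  assert (HQ3 : 0 < Q ^ 3) by (apply pow_lt; lra).
  assert (Hq2 : 0 < INR q ^ 2) by (apply pow_lt; lra).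
  assert (Hpos : 0 <= INR q ^ 2 / (27 * Q ^ 3)) by (apply Rdiv_le_0_compat; lra).
  rewrite (near_int_measure_window _ p); unfold Rdiv in *; try lra.
  replace 1 with (27 * Q ^ 3 * / INR q ^ 2 * (INR q ^ 2 * / (27 * Q ^ 3))) by (field; lra).
  apply Rmult_le_compat_l; [|exact Hlo].
  apply Rdiv_le_0_compat; lra.
- intros j _. rewrite <- Rmult_minus_distr_l.
  assert (0 < INR (S j)) by (apply lt_0_INR; lia).
  assert (0 < INR (S j) ^ 2) by (apply pow_lt; lra).
  assert (0 < Q ^ 3) by (apply pow_lt; lra).
  apply Rmult_le_pos; [apply Rdiv_le_0_compat; lra|].
  apply Rge_le, Rge_minus, Rle_ge. apply near_int_measure_le; [apply Rdiv_lt_0_compat; lra|].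
  apply Rmult_le_compat_l; [lra|]. now apply slope_antitone.
Qed.

(** The slope is at most [x / N^2], so denominator [q] contributes at most [27 Q^3 / q^2 * 4 * (3 /
    Q) * q x / N^2 = 324 (N / Q) / q]. The lower bound [3 / Q] on the final slope is the one that
    [near_int_measure_diff_le] requires. *)
Lemma potential_total x a N Q m n n' :
  0 < x -> 0 < a -> 0 < N -> 8 <= Q -> Q ^ 3 * x = N ^ 3 -> N <= INR n -> (n <= n')%nat ->
  3 / Q <= x / (INR n' + a) ^ 2 ->
  potential x a Q m n - potential x a Q m n' <= 324 * (N / Q) * Rsum (fun i => / INR (S i)) m.
Proof.
intros Hx Ha HN HQ8 HQ Hn Hnn Hb.
assert (H3Q : 0 < 3 / Q < 1 / 2) by (split; [apply Rdiv_lt_0_compat | apply Rlt_div_l]; lra).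
assert (HQ3 : 0 < Q ^ 3) by (apply pow_lt; lra).
unfold potential. rewrite <- Rsum_minus, <- Rsum_scal. apply Rsum_le. intros j _.
rewrite <- Rmult_minus_distr_l.
set (q := INR (S j)). assert (Hq : 1 <= q) by (change 1 with (INR 1); apply le_INR; lia).
assert (Hs : x / (INR n' + a) ^ 2 <= x / (INR n + a) ^ 2).
{ replace n' with (n + (n' - n))%nat by lia. now apply slope_antitone. }
assert (Hb2 : x / (INR n + a) ^ 2 <= x / N ^ 2).
{ apply Rmult_le_compat_l; [lra|]. apply Rinv_le_contravar; [apply pow_lt; lra|]. apply pow_incr; lra. }
apply Rle_trans with (27 * Q ^ 3 / q ^ 2 * (4 * (3 / Q) * (q * (x / N ^ 2)))).
- apply Rmult_le_compat_l; [apply Rdiv_le_0_compat; [lra | apply pow_lt; lra]|].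
  assert (0 <= x / (INR n' + a) ^ 2) by lra.
  eapply Rle_trans; [apply near_int_measure_diff_le|]; try lra.
  + nra.
  + apply Rmult_le_compat_l; lra.
  + apply Rmult_le_compat_l; [lra|]. apply Rmult_le_compat_l; lra.
- right. replace x with (N ^ 3 / Q ^ 3) by (rewrite <- HQ; field; lra). field. repeat split; lra.
Qed.

(** Greedy cutting, by strong induction on the remaining length [d]: each full block pays its 17
    with a unit of potential and its possible jump with a drop of the integer part; the final [Q]
    covers a last block that would overrun [M]. *)
Lemma dyadic_error_induction x a b N Q m M :
  0 < x -> 0 < a -> a <= b -> 0 < N -> 8 <= Q -> Q ^ 3 * x = N ^ 3 -> b - a <= Q ->
  INR m <= Q < INR m + 1 -> INR M + a <= 3 * N ->
  forall d n, N <= INR n -> (n + d = M)%nat ->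
  Rabs (Rsum (fun k => err x a b (n + k)) d)
  <= 17 * (potential x a Q m n - potential x a Q m M)
     + Q * (IZR (Int_part (x / (INR n + a) - x / (INR n + b)))
               - IZR (Int_part (x / (INR M + a) - x / (INR M + b)))) + Q.
Proof.
intros Hx Ha Hb HN HQ8 HQ Hc Hm HM.
assert (Hm1 : (1 <= m)%nat).
{ destruct m; [simpl in Hm; lra | lia]. }
induction d as [d IH] using lt_wf_ind. intros n Hn Hd.
destruct (dirichlet_approx (x / (INR n + a) ^ 2) m Hm1) as (p & q & Hq & Hbez & Hdir).
assert (HqQ : INR q <= Q) by (apply Rle_trans with (INR m); [apply le_INR; lia | lra]).
assert (Hdir' : Rabs (INR q * (x / (INR n + a) ^ 2) - IZR p) <= / Q).
{ eapply Rle_trans; [exact Hdir|]. apply Rinv_le_contravar; lra. }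
destruct (le_lt_dec q d) as [Hqd|Hqd].
- assert (Hq3 : INR n + a + INR q <= 3 * N).
  { assert (INR n + INR q <= INR M) by (rewrite <- plus_INR; apply le_INR; lia). lra. }
  pose proof (block_error x a b N Q n p q Hx Ha Hb HN HQ Hn Hc (proj1 Hq) HqQ Hbez Hdir') as HB.
  pose proof (potential_drop x a N Q m n p q Hx Ha HN HQ8 HQ Hn Hq3 Hq HqQ Hdir') as HP.
  assert (HI := IH (d - q)%nat ltac:(lia) (n + q)%nat ltac:(rewrite plus_INR; pose proof (pos_INR q); lra) ltac:(lia)).
  replace d with (q + (d - q))%nat at 1 by lia. rewrite Rsum_add.
  rewrite (Rsum_ext (fun i => err x a b (n + (q + i))) (fun k => err x a b (n + q + k)))
    by (intros; f_equal; lia).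
  eapply Rle_trans; [apply Rabs_triang|]. nra.
- assert (H1 : Rabs (Rsum (fun k => err x a b (n + k)) d) <= Q).
  { eapply Rle_trans; [apply Rsum_abs_const; intros; apply err_abs_le|].
    rewrite Rmult_1_r. apply Rle_trans with (INR q); [apply le_INR; lia | exact HqQ]. }
  assert (H2 : potential x a Q m M <= potential x a Q m n).
  { unfold potential. apply Rsum_le. intros j _.
    assert (0 < INR (S j)) by (apply lt_0_INR; lia).
    assert (0 < INR (S j) ^ 2) by (apply pow_lt; lra).
    assert (0 < Q ^ 3) by (apply pow_lt; lra).
    apply Rmult_le_compat_l; [apply Rdiv_le_0_compat; lra|].
    apply near_int_measure_le; [apply Rdiv_lt_0_compat; lra|].
    apply Rmult_le_compat_l; [lra|]. rewrite <- Hd. now apply slope_antitone. }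
  assert (H3 := gap_antitone x a b n d Hx Ha Hb). rewrite Hd in H3. apply Int_part_le in H3.
  nra.
Qed.

(** * Fourth roots and the sum over dyadic ranges *)

Definition root4 (t : R) : R := sqrt (sqrt t).

Lemma root4_nonneg t : 0 <= root4 t.
Proof. apply sqrt_pos. Qed.

Lemma root4_pow t : 0 <= t -> root4 t ^ 4 = t.
Proof.
intros H. unfold root4. replace (sqrt (sqrt t) ^ 4) with ((sqrt (sqrt t) ^ 2) ^ 2) by ring.
rewrite (pow2_sqrt (sqrt t)) by apply sqrt_pos. now apply pow2_sqrt.
Qed.

Lemma root4_le s t : s <= t -> root4 s <= root4 t.
Proof. intros H. now apply sqrt_le_1_alt, sqrt_le_1_alt. Qed.

Lemma root4_of_pow t : 0 <= t -> root4 (t ^ 4) = t.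
Proof.
intros H. unfold root4. replace (t ^ 4) with ((t ^ 2) ^ 2) by ring.
rewrite !sqrt_pow2; auto. nra.
Qed.

(** [(7 / 6)^4 < 2]; any ratio above 1 would make the dyadic sum geometric. *)
Lemma root4_double t : 0 <= t -> 7 / 6 * root4 t <= root4 (2 * t).
Proof.
intros H. pose proof (root4_nonneg t).
rewrite <- (root4_of_pow (7 / 6 * root4 t)) by lra.
apply root4_le. rewrite Rpow_mult_distr, root4_pow by assumption. lra.
Qed.

(** A fourth root in place of the logarithm, so that the bound for a dyadic range grows by a fixed
    ratio. If [u^4 = v^4 + 1] with [0 <= v <= u] and [u >= 1], then [4 u^3 (u - v) >= 1], hence
    [4 (u - v) >= 1 / u^4]. *)
Lemma harmonic_le m : Rsum (fun i => / INR (S i)) m <= 4 * root4 (INR m).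
Proof.
induction m as [|m IH]; cbn [Rsum]; [pose proof (root4_nonneg (INR 0)); lra|].
pose proof (pos_INR m) as Hm.
assert (Hv := root4_pow (INR m) Hm). assert (Hu := root4_pow (INR (S m)) (pos_INR _)).
assert (Hv0 := root4_nonneg (INR m)).
assert (Hvu : root4 (INR m) <= root4 (INR (S m))) by (apply root4_le; rewrite S_INR; lra).
assert (Hu1 : 1 <= root4 (INR (S m))).
{ replace 1 with (root4 (1 ^ 4)) at 1 by (apply root4_of_pow; lra). apply root4_le. rewrite S_INR. lra. }
set (u := root4 (INR (S m))) in *. set (v := root4 (INR m)) in *. rewrite <- Hu.
rewrite S_INR, <- Hv in Hu.
enough (/ u ^ 4 <= 4 * (u - v)) by lra.
assert (Hu4 : 0 < u ^ 4) by (apply pow_lt; lra).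
apply (Rmult_le_reg_l (u ^ 4)); [lra|]. rewrite Rinv_r by lra.
assert (H1 : (u - v) * (u ^ 3 + u ^ 2 * v + u * v ^ 2 + v ^ 3) = 1) by (ring_simplify; lra).
assert (H2 : u ^ 2 * v <= u ^ 3) by (replace (u ^ 3) with (u ^ 2 * u) by ring; apply Rmult_le_compat_l; nra).
assert (Hvv : v ^ 2 <= u ^ 2) by nra.
assert (H3 : u * v ^ 2 <= u ^ 3) by (replace (u ^ 3) with (u * u ^ 2) by ring; apply Rmult_le_compat_l; nra).
assert (H4 : v ^ 3 <= u ^ 3) by (apply pow_incr; lra).
assert (H5 : u ^ 3 <= u ^ 4) by (replace (u ^ 4) with (u ^ 3 * u) by ring; assert (0 <= u ^ 3) by (apply pow_le; lra); nra).
assert (H6 : (u - v) * (u ^ 3 + u ^ 2 * v + u * v ^ 2 + v ^ 3) <= (u - v) * (4 * u ^ 4)) by (apply Rmult_le_compat_l; lra).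
lra.
Qed.

Lemma gap_bounds x a b t : 0 < x -> 0 < t -> 0 <= a -> a <= b ->
  0 <= x / (t + a) - x / (t + b) <= (b - a) * x / t ^ 2.
Proof.
intros Hx Ht Ha Hb.
replace (x / (t + a) - x / (t + b)) with ((b - a) * x / ((t + a) * (t + b))) by (field; lra).
assert (0 < (t + a) * (t + b)) by (apply Rmult_lt_0_compat; lra).
assert (0 <= (b - a) * x) by (apply Rmult_le_pos; lra).
split; [apply Rdiv_le_0_compat; lra|].
apply Rmult_le_compat_l; [assumption|]. apply Rinv_le_contravar; [apply pow_lt; lra|]. nra.
Qed.

(** Here [X] is the cube root of [x] and [Q = N / X]. The constant is [22032 = 17 * 324 * 4]; the
    second term is [Q] times the bound [(b - a) x / N^2] for the integer part of the gap, and the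
    third is [Q] for the incomplete block. [27 N <= X^2] keeps the slope above [3 / Q] up to
    [2 N]. *)
Lemma dyadic_error x a b X (N : nat) :
  0 < x -> 0 < a -> a <= b -> 0 < X -> X ^ 3 = x -> 8 * X <= INR N -> a <= INR N ->
  (b - a) * X <= INR N -> 27 * INR N <= X ^ 2 ->
  Rabs (Rsum (fun k => err x a b (N + k)) N)
  <= 22032 * root4 (X ^ 3 * INR N) + (b - a) * X ^ 2 / INR N + INR N / X.
Proof.
intros Hx Ha Hb HX HX3 HN8 HaN HcN HNX.
assert (HN : 0 < INR N) by lra.
set (Q := INR N / X).
assert (HQ8 : 8 <= Q) by (apply (proj1 (Rle_div_r _ _ _ HX)); lra).
assert (HcQ : b - a <= Q) by (apply (proj1 (Rle_div_r _ _ _ HX)); lra).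
assert (HQ3 : Q ^ 3 * x = INR N ^ 3) by (unfold Q; rewrite <- HX3; field; lra).
destruct (nfloor_ex Q ltac:(lra)) as (m & Hm).
assert (HM : INR (N + N) + a <= 3 * INR N) by (rewrite plus_INR; lra).
pose proof (dyadic_error_induction x a b (INR N) Q m (N + N) Hx Ha Hb HN HQ8 HQ3 HcQ Hm HM N N (Rle_refl _) eq_refl) as H.
assert (Hbeta : 3 / Q <= x / (INR (N + N) + a) ^ 2).
{ apply Rle_trans with (x / (3 * INR N) ^ 2).
  - unfold Q. rewrite <- HX3. replace (3 / (INR N / X)) with (27 * INR N * X / (9 * INR N ^ 2)) by (field; lra).
    replace ((3 * INR N) ^ 2) with (9 * INR N ^ 2) by ring.
    apply Rmult_le_compat_r; [left; apply Rinv_0_lt_compat; nra|].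
    replace (X ^ 3) with (X ^ 2 * X) by ring. apply Rmult_le_compat_r; lra.
  - apply Rmult_le_compat_l; [lra|]. rewrite plus_INR in *.
    apply Rinv_le_contravar; [apply pow_lt|apply pow_incr]; lra. }
pose proof (potential_total x a (INR N) Q m N (N + N) Hx Ha HN HQ8 HQ3 (Rle_refl _) ltac:(lia) Hbeta) as HP.
replace (INR N / Q) with X in HP by (unfold Q; field; lra).
assert (HH : X * Rsum (fun i => / INR (S i)) m <= 4 * root4 (X ^ 3 * INR N)).
{ apply Rle_trans with (X * (4 * root4 Q)).
  - apply Rmult_le_compat_l; [lra|]. eapply Rle_trans; [apply harmonic_le|].
    apply Rmult_le_compat_l; [lra|]. apply root4_le; lra.
  - right. rewrite <- (root4_of_pow (X * (4 * root4 Q))).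
    2:{ pose proof (root4_nonneg Q). apply Rmult_le_pos; lra. }
    pose proof (root4_nonneg (X ^ 3 * INR N)) as H0.
    rewrite <- (root4_of_pow (4 * root4 (X ^ 3 * INR N))) by lra.
    f_equal. rewrite !Rpow_mult_distr, !root4_pow; unfold Q; [field; lra | | fold Q; lra].
    apply Rmult_le_pos; [apply pow_le|]; lra. }
destruct (gap_bounds x a b (INR N) Hx HN ltac:(lra) Hb) as [G1 G2].
destruct (gap_bounds x a b (INR (N + N)) Hx ltac:(rewrite plus_INR; lra) ltac:(lra) Hb) as [G3 G4].
apply Int_part_le in G3. rewrite (Int_part_unique 0 0) in G3 by lra.
destruct (base_Int_part (x / (INR N + a) - x / (INR N + b))) as [G5 _].
assert (HF : Q * (IZR (Int_part (x / (INR N + a) - x / (INR N + b)))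
        - IZR (Int_part (x / (INR (N + N) + a) - x / (INR (N + N) + b)))) <= (b - a) * X ^ 2 / INR N).
{ apply Rle_trans with (Q * ((b - a) * x / INR N ^ 2)); [apply Rmult_le_compat_l; lra|].
  right. unfold Q. rewrite <- HX3. field. lra. }
fold Q. lra.
Qed.

(** The root term grows by at least [7 / 6] per range, so its sum costs a factor 6, and
    [132192 = 6 * 22032]. The second term halves from range to range, which gives [2 (1 - / 2 ^ J)],
    and the third doubles. *)
Lemma dyadic_error_sum x a b X (N J : nat) :
  0 < x -> 0 < a -> a <= b -> 0 < X -> X ^ 3 = x -> 8 * X <= INR N -> a <= INR N ->
  (b - a) * X <= INR N -> (forall i, (i < J)%nat -> 27 * (2 ^ i * INR N) <= X ^ 2) ->
  Rabs (Rsum (fun k => err x a b (N + k)) ((2 ^ J - 1) * N))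
  <= 132192 * root4 (X ^ 3 * (2 ^ J * INR N)) + 2 * (b - a) * X ^ 2 / INR N * (1 - / 2 ^ J)
     + (2 ^ J * INR N) / X.
Proof.
intros Hx Ha Hb HX HX3 HN8 HaN HcN HJ.
assert (HN : 0 < INR N) by lra.
induction J as [|J IH].
- simpl. rewrite Rabs_R0. pose proof (root4_nonneg (X ^ 3 * (1 * INR N))).
  replace (1 - / 1) with 0 by field. rewrite Rmult_0_r.
  assert (0 <= 1 * INR N / X) by (apply Rdiv_le_0_compat; lra). simpl in *. lra.
- specialize (IH ltac:(intros; apply HJ; lia)).
  assert (HINR : INR (2 ^ J * N) = 2 ^ J * INR N) by (rewrite mult_INR, pow_INR; reflexivity).
  assert (H2J : 1 <= 2 ^ J) by (apply pow_R1_Rle; lra).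
  assert (Hle : INR N <= 2 ^ J * INR N) by nra.
  pose proof (dyadic_error x a b X (2 ^ J * N) Hx Ha Hb HX HX3) as HD. rewrite HINR in HD.
  specialize (HD ltac:(lra) ltac:(lra) ltac:(lra) (HJ J ltac:(lia))).
  assert (H2n : (1 <= 2 ^ J)%nat) by (apply Nat.neq_0_lt_0, Nat.pow_nonzero; lia).
  replace ((2 ^ S J - 1) * N)%nat with ((2 ^ J - 1) * N + 2 ^ J * N)%nat by (simpl; nia).
  rewrite Rsum_add.
  rewrite (Rsum_ext (fun i => err x a b (N + ((2 ^ J - 1) * N + i))) (fun k => err x a b (2 ^ J * N + k)))
    by (intros; f_equal; nia).
  eapply Rle_trans; [apply Rabs_triang|].
  assert (HR : 7 / 6 * root4 (X ^ 3 * (2 ^ J * INR N)) <= root4 (X ^ 3 * (2 ^ S J * INR N))).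
  { eapply Rle_trans; [apply root4_double|].
    - repeat apply Rmult_le_pos; try lra; apply pow_le; lra.
    - right. f_equal. simpl. ring. }
  assert (E1 : (b - a) * X ^ 2 / (2 ^ J * INR N) = 2 * (b - a) * X ^ 2 / INR N * (1 - / 2 ^ S J) - 2 * (b - a) * X ^ 2 / INR N * (1 - / 2 ^ J)).
  { simpl. field. lra. }
  assert (E2 : 2 ^ S J * INR N / X = 2 ^ J * INR N / X + 2 ^ J * INR N / X).
  { simpl. field. lra. }
  lra.
Qed.

(** A difference of fractional parts is at most the drop of the values plus the drop of their
    integer parts. Both are dominated by drops over a lag of [r] along [u], whence two telescoping
    sums and the factor 2. *)
Lemma frac_gap_tail x a b N n r :
  0 < x -> 0 < a -> a <= b -> b <= a + INR r -> 0 < INR N ->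
  Rsum (fun k => frac_gap x a b (N + k)) n <= 2 * INR r * x / INR N.
Proof.
intros Hx Ha Hb Hr HN.
set (u := fun k => x / (INR (N + k) + a)).
set (v := fun k => IZR (Int_part (u k))).
assert (Hup : forall k, 0 <= u k).
{ intros k. unfold u. pose proof (pos_INR (N + k)). apply Rdiv_le_0_compat; lra. }
assert (Hud : forall k l, (k <= l)%nat -> u l <= u k).
{ intros k l Hkl. unfold u. pose proof (pos_INR (N + k)).
  assert (INR (N + k) <= INR (N + l)) by (apply le_INR; lia).
  apply Rmult_le_compat_l; [lra|]. apply Rinv_le_contravar; lra. }
assert (Hvp : forall k, 0 <= v k).
{ intros k. unfold v. replace 0 with (IZR (Int_part 0)) by now rewrite (Int_part_unique 0 0) by lra.
  now apply Int_part_le. }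
assert (Hvd : forall k, v (S k) <= v k) by (intros; apply Int_part_le, Hud; lia).
assert (Hu0 : u 0%nat <= x / INR N).
{ unfold u. rewrite Nat.add_0_r. apply Rmult_le_compat_l; [lra|]. apply Rinv_le_contravar; lra. }
apply Rle_trans with (Rsum (fun k => (u k - u (k + r)%nat) + (v k - v (k + r)%nat)) n).
- apply Rsum_le. intros k _. unfold frac_gap.
  assert (H1 : x / (INR (N + k) + b) <= u k).
  { unfold u. pose proof (pos_INR (N + k)). apply Rmult_le_compat_l; [lra|]. apply Rinv_le_contravar; lra. }
  assert (H2 : u (k + r)%nat <= x / (INR (N + k) + b)).
  { unfold u. rewrite Nat.add_assoc, (plus_INR (N + k)). pose proof (pos_INR (N + k)).
    apply Rmult_le_compat_l; [lra|]. apply Rinv_le_contravar; lra. }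
  fold (u k). assert (H3 := Int_part_le _ _ H1). assert (H4 := Int_part_le _ _ H2).
  unfold v, frac_part. apply Rabs_le. lra.
- rewrite Rsum_plus.
  pose proof (Rsum_telescope_lag u r n Hup ltac:(intros; apply Hud; lia)).
  pose proof (Rsum_telescope_lag v r n Hvp Hvd).
  assert (v 0%nat <= u 0%nat) by (apply base_Int_part).
  pose proof (pos_INR r).
  assert (INR r * v 0%nat <= INR r * (x / INR N)) by (apply Rmult_le_compat_l; lra).
  assert (INR r * u 0%nat <= INR r * (x / INR N)) by (apply Rmult_le_compat_l; lra).
  replace (2 * INR r * x / INR N) with (INR r * (x / INR N) + INR r * (x / INR N)) by (field; lra). lra.
Qed.

(** * The Fresnel integral *)

Lemma le_of_nonneg_derive (g g' : R -> R) u v : u <= v ->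
  (forall w, u <= w <= v -> is_derive g w (g' w)) -> (forall w, u <= w <= v -> 0 <= g' w) ->
  g u <= g v.
Proof.
intros Huv Hd Hp.
destruct (MVT_gen g u v g') as (c & Hc & E).
- rewrite Rmin_left, Rmax_right by lra. intros w Hw. apply Hd; lra.
- rewrite Rmin_left, Rmax_right by lra. intros w Hw.
  apply continuity_pt_filterlim. apply (ex_derive_continuous g). exists (g' w). now apply Hd.
- rewrite Rmin_left, Rmax_right in Hc by lra. specialize (Hp c Hc).
  assert (0 <= g' c * (v - u)) by (apply Rmult_le_pos; lra). lra.
Qed.

(** Replaces the integral of an absolute value by a primitive [g] of its bound; most oscillatory
    estimates below take this form, with integration by parts absorbed into [f]. *)
Lemma abs_increment_le (f g f' g' : R -> R) u v : u <= v ->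
  (forall w, u <= w <= v -> is_derive f w (f' w)) ->
  (forall w, u <= w <= v -> is_derive g w (g' w)) ->
  (forall w, u <= w <= v -> Rabs (f' w) <= g' w) ->
  Rabs (f v - f u) <= g v - g u.
Proof.
intros Huv Hf Hg Hb.
assert (H1 : g u - f u <= g v - f v).
{ apply (le_of_nonneg_derive (fun w => g w - f w) (fun w => g' w - f' w)); auto.
  - intros w Hw. apply (is_derive_minus g f); auto.
  - intros w Hw. specialize (Hb w Hw). apply Rabs_le_between in Hb. lra. }
assert (H2 : g u + f u <= g v + f v).
{ apply (le_of_nonneg_derive (fun w => g w + f w) (fun w => g' w + f' w)); auto.
  - intros w Hw. apply (is_derive_plus g f); auto.
  - intros w Hw. specialize (Hb w Hw). apply Rabs_le_between in Hb. lra. }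
apply Rabs_le. lra.
Qed.

Lemma one_minus_cos_le z : 0 <= z -> 1 - cos z <= z.
Proof.
intros Hz. pose proof (abs_increment_le (fun z => 1 - cos z) (fun z => z) sin (fun _ => 1) 0 z Hz) as H.
cbv beta in H. rewrite cos_0 in H.
enough (Rabs (1 - cos z - (1 - 1)) <= z - 0) by (apply Rabs_le_between in H0; lra).
apply H; intros w _.
- auto_derive; [trivial | ring].
- auto_derive; [trivial | ring].
- apply Rabs_le. apply SIN_bound.
Qed.

Definition fresnel_sin (u : R) : R := RInt (fun w => sin (w ^ 2)) 0 u.
Definition fresnel_cos (u : R) : R := RInt (fun w => cos (w ^ 2)) 0 u.

Lemma is_derive_RInt_upper (f : R -> R) (a u : R) :
  (forall w, continuous f w) -> is_derive (fun u => RInt f a u) u (f u).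
Proof.
intros Hf. apply is_derive_RInt with a.
- exists (mkposreal 1 Rlt_0_1). intros y _. apply (RInt_correct (V := R_CompleteNormedModule)).
  apply (ex_RInt_continuous (V := R_CompleteNormedModule)). intros; apply Hf.
- apply Hf.
Qed.

Lemma is_derive_fresnel_sin u : is_derive fresnel_sin u (sin (u ^ 2)).
Proof.
apply (is_derive_RInt_upper (fun w => sin (w ^ 2))).
intros w. apply (ex_derive_continuous (fun w => sin (w ^ 2))). auto_derive; trivial.
Qed.

Lemma is_derive_fresnel_cos u : is_derive fresnel_cos u (cos (u ^ 2)).
Proof.
apply (is_derive_RInt_upper (fun w => cos (w ^ 2))).
intros w. apply (ex_derive_continuous (fun w => cos (w ^ 2))). auto_derive; trivial.
Qed.

Lemma fresnel_sin_0 : fresnel_sin 0 = 0.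
Proof. unfold fresnel_sin. now rewrite RInt_point. Qed.

Lemma fresnel_cos_0 : fresnel_cos 0 = 0.
Proof. unfold fresnel_cos. now rewrite RInt_point. Qed.

Lemma fresnel_sin_le u : 0 <= u -> Rabs (fresnel_sin u) <= u.
Proof.
intros Hu. replace (fresnel_sin u) with (fresnel_sin u - fresnel_sin 0) by (rewrite fresnel_sin_0; ring).
replace u with (u - 0) at 2 by ring.
apply (abs_increment_le fresnel_sin (fun z => z) (fun w => sin (w ^ 2)) (fun _ => 1)); auto.
- intros w _. apply is_derive_fresnel_sin.
- intros w _. auto_derive; trivial.
- intros w _. apply Rabs_le. apply SIN_bound.
Qed.

(** Integration by parts: [F w + cos (w^2 + th) / (2 w)] has derivative of size at most
    [1 / (2 w^2)]. The phase [th] treats sine and cosine together, with [th = 0] and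
    [th = PI / 2]. *)
Lemma fresnel_increment_le (F : R -> R) (th u v : R) :
  (forall w, is_derive F w (sin (w ^ 2 + th))) ->
  0 < u -> u <= v -> Rabs (F v - F u) <= / u.
Proof.
intros HF Hu Huv.
assert (H : Rabs ((F v + cos (v ^ 2 + th) / (2 * v)) - (F u + cos (u ^ 2 + th) / (2 * u)))
  <= (- / (2 * v)) - (- / (2 * u))).
{ apply (abs_increment_le (fun w => F w + cos (w ^ 2 + th) / (2 * w)) (fun w => - / (2 * w))
    (fun w => - cos (w ^ 2 + th) / (2 * w ^ 2)) (fun w => / (2 * w ^ 2))); auto.
  - intros w Hw.
    evar_last.
    + apply (is_derive_plus F); [apply HF|]. auto_derive; [lra | reflexivity].
    + unfold plus; simpl. field. lra.
  - intros w Hw. auto_derive; [lra|]. field. lra.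
  - intros w Hw. assert (0 < 2 * w ^ 2) by (assert (0 < w ^ 2) by (apply pow_lt; lra); lra).
    unfold Rdiv. rewrite Rabs_mult, Rabs_Ropp, (Rabs_right (/ (2 * w ^ 2))).
    2:{ left; now apply Rinv_0_lt_compat. }
    rewrite <- (Rmult_1_l (/ (2 * w ^ 2))) at 2. apply Rmult_le_compat_r; [left; now apply Rinv_0_lt_compat|].
    apply Rabs_le, COS_bound. }
assert (Hc : forall w, 0 < w -> Rabs (cos (w ^ 2 + th) / (2 * w)) <= / (2 * w)).
{ intros w Hw. unfold Rdiv. rewrite Rabs_mult, (Rabs_right (/ (2 * w))).
  2:{ left; apply Rinv_0_lt_compat; lra. }
  rewrite <- (Rmult_1_l (/ (2 * w))) at 2. apply Rmult_le_compat_r; [left; apply Rinv_0_lt_compat; lra|].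
  apply Rabs_le, COS_bound. }
assert (H1 := Hc u Hu). assert (H2 := Hc v ltac:(lra)).
apply Rabs_le_between in H, H1, H2. replace (/ u) with (/ (2 * u) + / (2 * u)) by (field; lra).
apply Rabs_le. lra.
Qed.

Lemma fresnel_limit (F : R -> R) th :
  (forall w, is_derive F w (sin (w ^ 2 + th))) ->
  exists l, forall u, 0 < u -> Rabs (F u - l) <= / u.
Proof.
intros HF.
assert (Hc : ex_finite_lim_seq (fun n => F (INR (S n)))).
{ apply ex_lim_seq_cauchy_corr. intros eps.
  destruct (nfloor_ex (2 / eps)) as (N & HN).
  { apply Rdiv_le_0_compat; [lra | apply eps]. }
  assert (Hb : forall n, (N <= n)%nat -> Rabs (F (INR (S n)) - F (INR (S N))) <= / INR (S N)).
  { intros n Hn. apply fresnel_increment_le with th; auto; [apply lt_0_INR; lia | apply le_INR; lia]. }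
  assert (HN2 : 2 * / INR (S N) < eps).
  { apply (proj2 (Rlt_div_l 2 eps (INR (S N)) (lt_0_INR (S N) ltac:(lia)))). rewrite S_INR.
    destruct HN as [_ HN]. apply Rlt_div_l in HN; [lra | apply eps]. }
  exists N. intros n m Hn Hm. specialize (Hb n Hn) as H1. specialize (Hb m Hm) as H2.
  apply Rabs_le_between in H1, H2. apply Rabs_lt_between. lra. }
destruct Hc as (l & Hl). exists l. intros u Hu.
assert (HL : is_lim_seq (fun n => Rabs (F u - F (INR (S n)))) (Rabs (F u - l))).
{ apply (is_lim_seq_abs _ (F u - l)). apply is_lim_seq_minus' with (2 := Hl). apply is_lim_seq_const. }
refine (is_lim_seq_le_loc _ (fun _ => / u) _ _ _ HL (is_lim_seq_const (/ u))).
destruct (nfloor_ex u ltac:(lra)) as (N & HN). exists N. intros n Hn.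
rewrite Rabs_minus_sym. apply fresnel_increment_le with th; auto.
rewrite S_INR. apply le_INR in Hn. lra.
Qed.

(** The oscillatory counterpart of the parametric proof of the Gaussian integral. Up to sign, the
    integral over [y] in [[0, 1]] has the [t]-derivative of [2 C S] for [th = 0] and of [C^2 - S^2]
    for [th = - PI / 2], where [C] and [S] are the Fresnel integrals up to [t]. As it tends to 0
    when [t] grows, both quadratic expressions have known limits. *)
Definition fresnel_kernel (th t y : R) : R := cos (t ^ 2 * (1 + y ^ 2) + th) / (1 + y ^ 2).

Lemma continuous_fresnel_kernel th t y : continuous (fresnel_kernel th t) y.
Proof.
apply (ex_derive_continuous (fresnel_kernel th t)). unfold fresnel_kernel.
auto_derive. nra.
Qed.

Lemma is_derive_fresnel_kernel (th t y : R) :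
  is_derive (fun z => fresnel_kernel th z y) t (- (2 * t * sin (t ^ 2 * (1 + y ^ 2) + th))).
Proof. unfold fresnel_kernel. assert (1 + y ^ 2 <> 0) by nra. auto_derive; [nra|]. cbn [pow]. field. nra. Qed.

Lemma is_derive_fresnel_kernel_int (th t : R) :
  is_derive (fun t => RInt (fresnel_kernel th t) 0 1) t
    (- 2 * (sin (t ^ 2 + th) * fresnel_cos t + cos (t ^ 2 + th) * fresnel_sin t)).
Proof.
evar_last.
- apply (is_derive_RInt_param (fresnel_kernel th) 0 1 t).
  + exists (mkposreal 1 Rlt_0_1). intros z _ y _. eexists. apply is_derive_fresnel_kernel.
  + intros y _.
    apply continuity_2d_pt_ext with (fun u v => - (2 * u * sin (u ^ 2 * (1 + v ^ 2) + th))).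
    { intros u v. symmetry. apply is_derive_unique, is_derive_fresnel_kernel. }
    apply continuity_2d_pt_opp, continuity_2d_pt_mult.
    * apply continuity_2d_pt_mult; [apply continuity_2d_pt_const | apply continuity_2d_pt_id1].
    * apply (continuity_1d_2d_pt_comp sin).
      { apply continuity_sin. }
      simpl. repeat first [ apply continuity_2d_pt_plus | apply continuity_2d_pt_mult
        | apply continuity_2d_pt_id1 | apply continuity_2d_pt_id2 | apply continuity_2d_pt_const ].
  + exists (mkposreal 1 Rlt_0_1). intros z _. apply (ex_RInt_continuous (V := R_CompleteNormedModule)). intros; apply continuous_fresnel_kernel.
- rewrite (RInt_ext _ (fun y => (- 2 * sin (t ^ 2 + th)) * (t * cos ((t * y + 0) ^ 2))
      + (- 2 * cos (t ^ 2 + th)) * (t * sin ((t * y + 0) ^ 2)))).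
  2:{ intros y _. etransitivity; [apply is_derive_unique, is_derive_fresnel_kernel|].
      replace (t ^ 2 * (1 + y ^ 2) + th) with ((t ^ 2 + th) + (t * y + 0) ^ 2) by ring.
      rewrite sin_plus. match goal with |- @eq _ ?l ?r => change (@eq R l r) end. ring. }
  assert (Hc : forall z, continuous (fun y => cos (y ^ 2)) z).
  { intros z. apply (ex_derive_continuous (fun y => cos (y ^ 2))). auto_derive; trivial. }
  assert (Hs : forall z, continuous (fun y => sin (y ^ 2)) z).
  { intros z. apply (ex_derive_continuous (fun y => sin (y ^ 2))). auto_derive; trivial. }
  assert (Ec : is_RInt (fun y => t * cos ((t * y + 0) ^ 2)) 0 1 (fresnel_cos t)).
  { apply (is_RInt_comp_lin (fun y => cos (y ^ 2))).
    replace (t * 0 + 0) with 0 by ring. replace (t * 1 + 0) with t by ring.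
    apply (RInt_correct (V := R_CompleteNormedModule)), (ex_RInt_continuous (V := R_CompleteNormedModule)). intros; apply Hc. }
  assert (Es : is_RInt (fun y => t * sin ((t * y + 0) ^ 2)) 0 1 (fresnel_sin t)).
  { apply (is_RInt_comp_lin (fun y => sin (y ^ 2))).
    replace (t * 0 + 0) with 0 by ring. replace (t * 1 + 0) with t by ring.
    apply (RInt_correct (V := R_CompleteNormedModule)), (ex_RInt_continuous (V := R_CompleteNormedModule)). intros; apply Hs. }
  apply is_RInt_unique.
  replace (-2 * (sin (t ^ 2 + th) * fresnel_cos t + cos (t ^ 2 + th) * fresnel_sin t))
    with (plus (scal (-2 * sin (t ^ 2 + th)) (fresnel_cos t)) (scal (-2 * cos (t ^ 2 + th)) (fresnel_sin t)))
    by (unfold plus, scal; simpl; unfold mult; simpl; ring).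
  apply (is_RInt_plus (V := R_NormedModule)); apply (is_RInt_scal (V := R_NormedModule)); assumption.
Qed.

(* The phase of the kernel is stationary at [y = 0], so integrate by parts on [[1 / t, 1]] only. *)
Lemma fresnel_kernel_int_le th t : 1 <= t -> Rabs (RInt (fresnel_kernel th t) 0 1) <= 4 / t.
Proof.
intros Ht. set (G := fun y => RInt (fresnel_kernel th t) 0 y).
assert (HG : forall y, is_derive G y (fresnel_kernel th t y)).
{ intros y. apply (is_derive_RInt_upper (fresnel_kernel th t)). intros; apply continuous_fresnel_kernel. }
assert (G0 : G 0 = 0) by (unfold G; now rewrite RInt_point).
(* [1 / t] balances the trivial bound [e] on [[0, e]] against boundary terms of order
   [1 / (t^2 e)]. *)
set (e := / t). assert (He : 0 < e <= 1).
{ unfold e. split; [apply Rinv_0_lt_compat; lra|]. rewrite <- Rinv_1. apply Rinv_le_contravar; lra. }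
assert (Hte : t * e = 1) by (unfold e; field; lra).
assert (H1 : Rabs (G e - G 0) <= e - 0).
{ apply (abs_increment_le G (fun z => z) (fresnel_kernel th t) (fun _ => 1)); auto; try lra.
  - intros w _. auto_derive; trivial.
  - intros w _. unfold fresnel_kernel, Rdiv. assert (1 <= 1 + w ^ 2) by nra.
    rewrite Rabs_mult, <- (Rmult_1_l 1). apply Rmult_le_compat; try apply Rabs_pos.
    + apply Rabs_le, COS_bound.
    + rewrite Rabs_right by (left; apply Rinv_0_lt_compat; lra).
      rewrite <- Rinv_1. apply Rinv_le_contravar; lra. }
set (B := fun y => sin (t ^ 2 * (1 + y ^ 2) + th) / (2 * t ^ 2 * y * (1 + y ^ 2))).
assert (Ht2 : 0 < t ^ 2) by (apply pow_lt; lra).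
assert (H2 : Rabs ((G 1 - B 1) - (G e - B e)) <= (- (3 / (2 * t ^ 2 * 1))) - (- (3 / (2 * t ^ 2 * e)))).
{ apply (abs_increment_le (fun y => G y - B y) (fun y => - (3 / (2 * t ^ 2 * y)))
    (fun y => sin (t ^ 2 * (1 + y ^ 2) + th) * ((1 + 3 * y ^ 2) / (2 * t ^ 2 * y ^ 2 * (1 + y ^ 2) ^ 2)))
    (fun y => 3 / (2 * t ^ 2 * y ^ 2))); try lra.
  - intros w Hw. evar_last.
    + apply (is_derive_minus G B); [apply HG|]. unfold B. auto_derive; [|reflexivity].
      assert (0 < w) by lra. assert (0 < w * w) by nra. assert (0 < t * t) by nra.
      repeat apply Rmult_integral_contrapositive_currified; nra.
    + unfold fresnel_kernel, minus, plus, opp; simpl. field. repeat split; nra.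
  - intros w Hw. auto_derive; [simpl in Ht2; apply Rmult_integral_contrapositive_currified; lra|].
    field. lra.
  - intros w Hw. assert (Hw2 : 0 < w ^ 2) by (apply pow_lt; lra).
    assert (0 < 2 * t ^ 2 * w ^ 2) by nra.
    rewrite Rabs_mult. rewrite <- (Rmult_1_l (3 / (2 * t ^ 2 * w ^ 2))).
    apply Rmult_le_compat; try apply Rabs_pos.
    + apply Rabs_le, SIN_bound.
    + assert (Hp : 0 < (1 + w ^ 2) ^ 2) by (apply pow_lt; lra).
      rewrite Rabs_right.
      2:{ apply Rle_ge, Rdiv_le_0_compat; [lra|]. now apply Rmult_lt_0_compat. }
      apply Rle_div_l; [now apply Rmult_lt_0_compat|].
      replace (3 / (2 * t ^ 2 * w ^ 2) * (2 * t ^ 2 * w ^ 2 * (1 + w ^ 2) ^ 2)) with (3 * (1 + w ^ 2) ^ 2)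
        by (field; lra).
      nra. }
assert (HB : forall y, 0 < y -> Rabs (B y) <= / (2 * t ^ 2 * y)).
{ intros y Hy. unfold B. assert (Hp : 0 < 2 * t ^ 2 * y) by (apply Rmult_lt_0_compat; lra).
  assert (1 <= 1 + y ^ 2) by nra.
  unfold Rdiv. rewrite Rabs_mult, <- (Rmult_1_l (/ (2 * t ^ 2 * y))).
  apply Rmult_le_compat; try apply Rabs_pos; [apply Rabs_le, SIN_bound|].
  rewrite Rabs_right by (left; apply Rinv_0_lt_compat, Rmult_lt_0_compat; lra).
  apply Rinv_le_contravar; nra. }
assert (B1 := HB 1 ltac:(lra)). assert (B2 := HB e ltac:(lra)).
replace (2 * t ^ 2 * e) with (2 * t) in * by (rewrite <- (Rmult_1_r (2 * t)), <- Hte; ring).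
assert (H3 : / (2 * t ^ 2 * 1) <= / (2 * t)) by (apply Rinv_le_contravar; nra).
assert (H4 : 0 < / (2 * t ^ 2 * 1)) by (apply Rinv_0_lt_compat; lra).
replace (4 / t) with (8 * / (2 * t)) by (field; lra).
replace e with (2 * / (2 * t)) in H1 by (unfold e; field; lra).
unfold Rdiv in *. rewrite G0 in H1. apply Rabs_le_between in H1, H2, B1, B2.
change (Rabs (G 1) <= 8 * / (2 * t)).
apply Rabs_le.
replace (2 * / (2 * t)) with e in * by (unfold e; field; lra). unfold Rminus in *.
assert (e = 2 * / (2 * t)) by (unfold e; field; lra). lra.
Qed.

Lemma fresnel_kernel_int_0 : RInt (fresnel_kernel 0 0) 0 1 = PI / 4.
Proof.
rewrite (RInt_ext _ (fun y => / (1 + y ^ 2))).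
2:{ intros y _. unfold fresnel_kernel. replace (0 ^ 2 * (1 + y ^ 2) + 0) with 0 by ring.
    rewrite cos_0. unfold Rdiv. apply Rmult_1_l. }
rewrite <- atan_1. replace (atan 1) with (atan 1 - atan 0) by (rewrite atan_0; ring).
apply is_RInt_unique. apply (is_RInt_derive atan).
- intros y _. rewrite <- Rsqr_pow2. apply is_derive_atan.
- intros y _. apply (ex_derive_continuous (fun y => / (1 + y ^ 2))). auto_derive. nra.
Qed.

Lemma const_of_derive_0 (g : R -> R) u : 0 <= u -> (forall w, is_derive g w 0) -> g u = g 0.
Proof.
intros Hu Hg. pose proof (abs_increment_le g (fun _ => 0) (fun _ => 0) (fun _ => 0) 0 u Hu) as H.
assert (H' : Rabs (g u - g 0) <= 0 - 0).
{ apply H; intros; auto; [apply (is_derive_const 0) | rewrite Rabs_R0; lra]. }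
apply Rabs_le_between in H'. lra.
Qed.

Lemma fresnel_prod t : 0 <= t ->
  2 * fresnel_cos t * fresnel_sin t = PI / 4 - RInt (fresnel_kernel 0 t) 0 1.
Proof.
intros Ht. pose proof (const_of_derive_0
  (fun t => 2 * fresnel_cos t * fresnel_sin t + RInt (fresnel_kernel 0 t) 0 1) t Ht) as H.
cbv beta in H. rewrite fresnel_kernel_int_0, fresnel_cos_0 in H.
enough (E : 2 * fresnel_cos t * fresnel_sin t + RInt (fresnel_kernel 0 t) 0 1 = 2 * 0 * fresnel_sin 0 + PI / 4) by lra.
apply H. intros w. evar_last.
- apply (is_derive_plus (fun t => 2 * fresnel_cos t * fresnel_sin t)).
  + apply (is_derive_mult (fun t => 2 * fresnel_cos t)); [|apply is_derive_fresnel_sin | apply Rmult_comm].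
    apply (is_derive_scal fresnel_cos). apply is_derive_fresnel_cos.
  + apply is_derive_fresnel_kernel_int.
- unfold plus, mult; simpl. rewrite !Rplus_0_r. ring.
Qed.

Lemma fresnel_diff_squares t : 0 <= t ->
  fresnel_cos t ^ 2 - fresnel_sin t ^ 2 = RInt (fresnel_kernel (- (PI / 2)) t) 0 1.
Proof.
intros Ht. pose proof (const_of_derive_0
  (fun t => fresnel_cos t * fresnel_cos t - fresnel_sin t * fresnel_sin t
            - RInt (fresnel_kernel (- (PI / 2)) t) 0 1) t Ht) as H.
assert (H0 : RInt (fresnel_kernel (- (PI / 2)) 0) 0 1 = 0).
{ rewrite (RInt_ext _ (fun _ => 0)).
  - rewrite RInt_const. apply Rmult_0_r.
  - intros y _. unfold fresnel_kernel. replace (0 ^ 2 * (1 + y ^ 2) + - (PI / 2)) with (- (PI / 2)) by ring.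
    rewrite cos_neg, cos_PI2. apply Rmult_0_l. }
cbv beta in H. rewrite H0, fresnel_cos_0, fresnel_sin_0 in H.
enough (E : fresnel_cos t * fresnel_cos t - fresnel_sin t * fresnel_sin t - RInt (fresnel_kernel (- (PI / 2)) t) 0 1 = 0 * 0 - 0 * 0 - 0) by lra.
apply H. intros w. evar_last.
- apply (is_derive_minus (fun t => fresnel_cos t * fresnel_cos t - fresnel_sin t * fresnel_sin t)).
  + apply (is_derive_minus (fun t => fresnel_cos t * fresnel_cos t)).
    * apply (is_derive_mult fresnel_cos fresnel_cos); [apply is_derive_fresnel_cos .. | apply Rmult_comm].
    * apply (is_derive_mult fresnel_sin fresnel_sin); [apply is_derive_fresnel_sin .. | apply Rmult_comm].
  + apply is_derive_fresnel_kernel_int.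
- unfold minus, opp, plus, mult; simpl.
  replace (w * (w * 1) + - (PI / 2)) with (- (PI / 2 - w * (w * 1))) by ring.
  rewrite sin_neg, cos_neg, sin_shift, cos_shift. ring.
Qed.

(** Fixes the sign of the limit, which the quadratic relations leave open. The function
    [2 S(u) - (1 - cos (u^2)) / u] has derivative [(1 - cos (u^2)) / u^2 >= 0]. Being undefined at
    0, it is compared with its value at a small [e], which is at least [- 3 e]. *)
Lemma fresnel_sin_nonneg u : 0 <= u -> 0 <= fresnel_sin u.
Proof.
intros Hu. destruct (Rle_dec 0 (fresnel_sin u)) as [|Hn]; [assumption|exfalso].
assert (Hu0 : 0 < u).
{ destruct (Req_dec u 0) as [->|]; [rewrite fresnel_sin_0 in Hn|]; lra. }
set (e := Rmin u (- fresnel_sin u / 3)).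
assert (He : 0 < e) by (apply Rmin_glb_lt; lra).
assert (He2 : 3 * e <= - fresnel_sin u) by (assert (e <= - fresnel_sin u / 3) by apply Rmin_r; lra).
assert (H : 2 * fresnel_sin e - (1 - cos (e ^ 2)) / e <= 2 * fresnel_sin u - (1 - cos (u ^ 2)) / u).
{ apply (le_of_nonneg_derive (fun u => 2 * fresnel_sin u - (1 - cos (u ^ 2)) / u)
    (fun u => (1 - cos (u ^ 2)) / u ^ 2)); [apply Rmin_l | |].
  - intros w Hw. evar_last.
    + apply (is_derive_minus (fun u => 2 * fresnel_sin u)).
      * apply (is_derive_scal fresnel_sin), is_derive_fresnel_sin.
      * auto_derive; [lra | reflexivity].
    + unfold minus, opp, plus; simpl. field. lra.
  - intros w Hw. apply Rdiv_le_0_compat; [|apply pow_lt; lra].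
    pose proof (COS_bound (w ^ 2)). lra. }
assert (H1 := fresnel_sin_le e ltac:(lra)). apply Rabs_le_between in H1.
assert (H2 := one_minus_cos_le (e ^ 2) ltac:(nra)).
assert (H3 : (1 - cos (e ^ 2)) / e <= e) by (apply Rle_div_l; nra).
assert (H4 : 0 <= (1 - cos (u ^ 2)) / u) by (apply Rdiv_le_0_compat; [pose proof (COS_bound (u ^ 2)) |]; lra).
lra.
Qed.

Lemma is_lim_seq_of_inv_bound (w : nat -> R) l k :
  (forall n, Rabs (w n - l) <= k / INR (S n)) -> is_lim_seq w l.
Proof.
intros H. apply is_lim_seq_ext with (fun n => l + (w n - l)); [intros; ring|].
replace (Finite l) with (Finite (l + 0)) by (f_equal; ring).
apply is_lim_seq_plus'; [apply is_lim_seq_const|].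
apply is_lim_seq_abs_0.
apply is_lim_seq_le_le with (fun _ => 0) (fun n => k * / INR (S n)).
- intros n. split; [apply Rabs_pos | apply H].
- apply is_lim_seq_const.
- replace (Finite 0) with (Rbar_mult k 0) by (simpl; f_equal; ring).
  apply is_lim_seq_scal_l.
  apply (is_lim_seq_incr_1 (fun n => / INR n)).
  apply (is_lim_seq_inv _ p_infty); [apply is_lim_seq_INR | discriminate].
Qed.

(** The limits satisfy [2 lc ls = PI / 4] and [lc^2 = ls^2]. The first relation excludes
    [lc = - ls], so [ls^2 = PI / 8], and [ls >= 0] selects the root. *)
Lemma fresnel_sin_infty u : 0 < u -> Rabs (fresnel_sin u - sqrt (PI / 8)) <= / u.
Proof.
assert (HS : forall w, is_derive fresnel_sin w (sin (w ^ 2 + 0))).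
{ intros w. rewrite Rplus_0_r. apply is_derive_fresnel_sin. }
assert (HC : forall w, is_derive fresnel_cos w (sin (w ^ 2 + PI / 2))).
{ intros w. replace (w ^ 2 + PI / 2) with (PI / 2 + w ^ 2) by ring.
  rewrite <- cos_sin. apply is_derive_fresnel_cos. }
destruct (fresnel_limit _ _ HS) as (ls & Hls). destruct (fresnel_limit _ _ HC) as (lc & Hlc).
assert (Hn : forall n, 0 < INR (S n)) by (intros; apply lt_0_INR; lia).
assert (Hn1 : forall n, 1 <= INR (S n)) by (intros; rewrite S_INR; pose proof (pos_INR n); lra).
assert (Ls : is_lim_seq (fun n => fresnel_sin (INR (S n))) ls).
{ apply is_lim_seq_of_inv_bound with 1. intros n. unfold Rdiv. rewrite Rmult_1_l. now apply Hls. }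
assert (Lc : is_lim_seq (fun n => fresnel_cos (INR (S n))) lc).
{ apply is_lim_seq_of_inv_bound with 1. intros n. unfold Rdiv. rewrite Rmult_1_l. now apply Hlc. }
assert (E1 : 2 * lc * ls = PI / 4).
{ assert (A : is_lim_seq (fun n => 2 * fresnel_cos (INR (S n)) * fresnel_sin (INR (S n))) (2 * lc * ls)).
  { apply is_lim_seq_mult'; [|exact Ls]. apply is_lim_seq_mult'; [apply is_lim_seq_const | exact Lc]. }
  assert (B : is_lim_seq (fun n => 2 * fresnel_cos (INR (S n)) * fresnel_sin (INR (S n))) (PI / 4)).
  { apply is_lim_seq_of_inv_bound with 4. intros n. rewrite fresnel_prod by (left; apply Hn).
    replace (PI / 4 - RInt (fresnel_kernel 0 (INR (S n))) 0 1 - PI / 4)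
      with (- RInt (fresnel_kernel 0 (INR (S n))) 0 1) by ring.
    rewrite Rabs_Ropp. now apply fresnel_kernel_int_le. }
  apply is_lim_seq_unique in A, B. rewrite A in B. now injection B. }
assert (E2 : lc ^ 2 - ls ^ 2 = 0).
{ assert (A : is_lim_seq (fun n => fresnel_cos (INR (S n)) ^ 2 - fresnel_sin (INR (S n)) ^ 2) (lc ^ 2 - ls ^ 2)).
  { simpl. apply is_lim_seq_minus'; repeat apply is_lim_seq_mult'; auto; apply is_lim_seq_const. }
  assert (B : is_lim_seq (fun n => fresnel_cos (INR (S n)) ^ 2 - fresnel_sin (INR (S n)) ^ 2) 0).
  { apply is_lim_seq_of_inv_bound with 4. intros n. rewrite fresnel_diff_squares by (left; apply Hn).
    rewrite Rminus_0_r. now apply fresnel_kernel_int_le. }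
  apply is_lim_seq_unique in A, B. rewrite A in B. now injection B. }
assert (Hpos : 0 <= ls).
{ apply (is_lim_seq_le (fun _ => 0) (fun n => fresnel_sin (INR (S n))) 0 ls);
    [|apply is_lim_seq_const | exact Ls]. intros n. apply fresnel_sin_nonneg. left; apply Hn. }
assert (HPI := PI_RGT_0).
assert (E3 : ls ^ 2 = PI / 8).
{ assert (Hf : (lc - ls) * (lc + ls) = 0) by (ring_simplify; lra).
  apply Rmult_integral in Hf. destruct Hf as [Hf|Hf]; nra. }
replace (sqrt (PI / 8)) with ls; [apply Hls|].
rewrite <- E3. symmetry. now apply sqrt_pow2.
Qed.

(** The substitution [w = sqrt al / t] and an integration by parts give the explicit primitive [A].
    At [T] its two terms are at most [al / T] and [2 al / T]; at [t0] each is within [2 t0] of its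
    limit for small [t0], and the Fresnel limit gives [2 sqrt al sqrt (PI / 8)]. *)
Lemma osc_integral al t0 T : 0 < al -> 0 < t0 -> t0 <= T ->
  ex_RInt (fun t => 1 - cos (al / t ^ 2)) t0 T /\
  Rabs (RInt (fun t => 1 - cos (al / t ^ 2)) t0 T - sqrt (PI * al / 2)) <= 4 * t0 + 3 * al / T.
Proof.
intros Hal Ht0 HT. assert (Hs : 0 < sqrt al) by now apply sqrt_lt_R0.
assert (Hss : sqrt al * sqrt al = al) by (apply sqrt_sqrt; lra).
set (A := fun t => t * (1 - cos (al / t ^ 2)) - 2 * sqrt al * fresnel_sin (sqrt al / t)).
assert (HI : is_RInt (fun t => 1 - cos (al / t ^ 2)) t0 T (A T - A t0)).
{ apply (is_RInt_derive A).
  - rewrite Rmin_left, Rmax_right by lra. intros t Ht. evar_last.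
    + apply (is_derive_minus (fun t => t * (1 - cos (al / t ^ 2)))).
      * auto_derive; [|reflexivity]. simpl. nra.
      * apply (is_derive_scal (fun t => fresnel_sin (sqrt al / t))).
        apply (is_derive_comp fresnel_sin); [apply is_derive_fresnel_sin|].
        auto_derive; [lra | reflexivity].
    + unfold minus, opp, plus, scal; simpl; unfold mult; simpl.
      replace (sqrt al / t * (sqrt al / t * 1)) with (al / t ^ 2) by (rewrite <- Hss at 1; field; lra).
      replace (al / (t * (t * 1))) with (al / t ^ 2) by (simpl; reflexivity).
      replace (al * / (t * (t * 1))) with (al / t ^ 2) by (simpl; reflexivity).
      set (s := sin (al / t ^ 2)).
      replace (2 * sqrt al * (sqrt al * (- (1) * / (t * t)) * s))
        with (2 * (sqrt al * sqrt al) * (- (1) * / (t * t)) * s) by ring.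
      rewrite Hss. field. lra.
  - rewrite Rmin_left, Rmax_right by lra. intros t Ht.
    apply (ex_derive_continuous (fun t => 1 - cos (al / t ^ 2))). auto_derive. simpl. nra. }
split; [eexists; exact HI|]. rewrite (is_RInt_unique _ _ _ _ HI).
replace (sqrt (PI * al / 2)) with (2 * sqrt al * sqrt (PI / 8)).
2:{ pose proof PI_RGT_0. rewrite <- (sqrt_pow2 2) at 1 by lra. rewrite <- !sqrt_mult by nra. f_equal. field. }
unfold A.
assert (B1 : 0 <= T * (1 - cos (al / T ^ 2)) <= al / T).
{ assert (0 < T ^ 2) by (apply pow_lt; lra). pose proof (COS_bound (al / T ^ 2)).
  split; [apply Rmult_le_pos; lra|].
  replace (al / T) with (T * (al / T ^ 2)) by (field; lra).
  apply Rmult_le_compat_l; [lra|]. apply one_minus_cos_le. apply Rdiv_le_0_compat; lra. }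
assert (B2 : 0 <= t0 * (1 - cos (al / t0 ^ 2)) <= 2 * t0) by (pose proof (COS_bound (al / t0 ^ 2)); nra).
assert (B3 := fresnel_sin_le (sqrt al / T) ltac:(apply Rdiv_le_0_compat; lra)).
assert (B4 := fresnel_sin_infty (sqrt al / t0) ltac:(apply Rdiv_lt_0_compat; lra)).
apply (Rmult_le_compat_l (2 * sqrt al)) in B3, B4; try lra.
replace (2 * sqrt al * (sqrt al / T)) with (2 * al / T) in B3 by (rewrite <- Hss at 1; field; lra).
replace (2 * sqrt al * / (sqrt al / t0)) with (2 * t0) in B4 by (field; lra).
rewrite <- (Rabs_right (2 * sqrt al)) in B3, B4 by lra. rewrite <- Rabs_mult in B3, B4.
apply Rabs_le_between in B3, B4. apply Rabs_le. unfold Rdiv in *. lra.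
Qed.

(** * The Fourier series of [phi] *)

Lemma is_derive_Rsum (f f' : nat -> R -> R) n v :
  (forall k, is_derive (f k) v (f' k v)) ->
  is_derive (fun v => Rsum (fun k => f k v) n) v (Rsum (fun k => f' k v) n).
Proof.
intros H. induction n as [|n IH]; simpl; [apply (is_derive_const 0)|].
apply (is_derive_plus (fun v => Rsum (fun k => f k v) n)); auto.
Qed.

Lemma dirichlet_kernel th n :
  sin th * (1 + 2 * Rsum (fun k => cos (2 * INR (S k) * th)) n) = sin ((2 * INR n + 1) * th).
Proof.
induction n as [|n IH].
- simpl. rewrite Rmult_0_r, Rplus_0_r, Rmult_1_r. f_equal. ring.
- cbn [Rsum]. rewrite S_INR.
  replace ((2 * (INR n + 1) + 1) * th) with (2 * (INR n + 1) * th + th) by ring.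
  replace ((2 * INR n + 1) * th) with (2 * (INR n + 1) * th - th) in IH by ring.
  rewrite sin_plus. rewrite sin_minus in IH. lra.
Qed.

(** Partial sums for [phi / 2], that is for [v (1 - v)] on [[0, 1]]. Written with [1 - cos], they
    vanish at 0 and need no constant term, hence no evaluation of the sum of [1 / k^2]. *)
Definition phi_fourier (n : nat) (v : R) : R :=
  Rsum (fun k => (1 - cos (2 * INR (S k) * (PI * v))) / (PI ^ 2 * INR (S k) ^ 2)) n.

Definition phi_fourier' (n : nat) (v : R) : R :=
  Rsum (fun k => 2 * sin (2 * INR (S k) * (PI * v)) / (PI * INR (S k))) n.

Lemma is_derive_phi_fourier n v : is_derive (phi_fourier n) v (phi_fourier' n v).
Proof.
apply (is_derive_Rsum (fun k v => (1 - cos (2 * INR (S k) * (PI * v))) / (PI ^ 2 * INR (S k) ^ 2))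
  (fun k v => 2 * sin (2 * INR (S k) * (PI * v)) / (PI * INR (S k)))).
intros k. assert (INR (S k) <> 0) by (apply not_0_INR; lia). pose proof PI_neq0.
generalize dependent (INR (S k)); intros q Hq.
auto_derive; [trivial|]. field. auto.
Qed.

Lemma is_derive_phi_fourier' n v :
  is_derive (phi_fourier' n) v (4 * Rsum (fun k => cos (2 * INR (S k) * (PI * v))) n).
Proof.
rewrite <- Rsum_scal.
apply (is_derive_Rsum (fun k v => 2 * sin (2 * INR (S k) * (PI * v)) / (PI * INR (S k)))
  (fun k v => 4 * cos (2 * INR (S k) * (PI * v)))).
intros k. assert (INR (S k) <> 0) by (apply not_0_INR; lia). pose proof PI_neq0.
generalize dependent (INR (S k)); intros q Hq.
auto_derive; [trivial|]. field. auto.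
Qed.

Lemma sin_INR_PI k : sin (INR k * PI) = 0.
Proof.
induction k as [|k IH]; [simpl; rewrite Rmult_0_l; apply sin_0|].
rewrite S_INR, Rmult_plus_distr_r, Rmult_1_l, neg_sin, IH. apply Ropp_0.
Qed.

(** By the Dirichlet kernel, [1 - 2 w - phi_fourier' n w] has derivative
    [- 2 sin (M w) / sin (PI w)]. Integration by parts gains [1 / M], and both the function and the
    boundary term vanish at [w = 1 / 2], so the increment from [v] to [1 / 2] is the whole
    quantity. *)
Lemma phi_fourier'_bound n v : 0 < v <= 1 / 2 ->
  Rabs (1 - 2 * v - phi_fourier' n v) <= 4 / ((2 * INR n + 1) * PI * sin (PI * v)).
Proof.
intros Hv. set (M := (2 * INR n + 1) * PI). pose proof PI_RGT_0 as HPI. pose proof (pos_INR n).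
assert (HM : 0 < M) by (apply Rmult_lt_0_compat; lra).
assert (Hsin : forall w, v <= w <= 1 / 2 -> 0 < sin (PI * w)) by (intros; apply sin_gt_0; nra).
set (f := fun w => (1 - 2 * w - phi_fourier' n w) - 2 * cos (M * w) / (M * sin (PI * w))).
set (g := fun w => - (2 / (M * sin (PI * w)))).
assert (HI : Rabs (f (1 / 2) - f v) <= g (1 / 2) - g v).
{ apply (abs_increment_le f g (fun w => 2 * PI * cos (M * w) * cos (PI * w) / (M * sin (PI * w) ^ 2))
    (fun w => 2 * PI * cos (PI * w) / (M * sin (PI * w) ^ 2))); [lra | | |]; intros w Hw; specialize (Hsin w Hw).
  - evar_last.
    + apply (is_derive_minus (fun w => 1 - 2 * w - phi_fourier' n w)).
      * apply (is_derive_minus (fun w => 1 - 2 * w)); [auto_derive; [trivial | reflexivity]|].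
        apply is_derive_phi_fourier'.
      * auto_derive; [apply Rmult_integral_contrapositive_currified; lra | reflexivity].
    + unfold minus, opp, plus; cbn -[INR].
      pose proof (dirichlet_kernel (PI * w) n) as HD.
      replace ((2 * INR n + 1) * (PI * w)) with (M * w) in HD by (unfold M; ring).
      set (D := Rsum (fun k => cos (2 * INR (S k) * (PI * w))) n) in *.
      rewrite <- HD. field. lra.
  - unfold g. auto_derive; [apply Rmult_integral_contrapositive_currified; lra|]. field. lra.
  - assert (0 <= cos (PI * w)) by (apply cos_ge_0; nra).
    replace (2 * PI * cos (M * w) * cos (PI * w) / (M * sin (PI * w) ^ 2))
      with (cos (M * w) * (2 * PI * cos (PI * w) / (M * sin (PI * w) ^ 2))) by (field; lra).
    assert (0 < sin (PI * w) ^ 2) by (apply pow_lt; lra).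
    assert (0 <= 2 * PI * cos (PI * w) / (M * sin (PI * w) ^ 2)).
    { apply Rdiv_le_0_compat; [apply Rmult_le_pos; lra | apply Rmult_lt_0_compat; lra]. }
    rewrite Rabs_mult, (Rabs_right (2 * PI * cos (PI * w) / (M * sin (PI * w) ^ 2))) by lra.
    rewrite <- (Rmult_1_l (2 * PI * cos (PI * w) / (M * sin (PI * w) ^ 2))) at 2.
    apply Rmult_le_compat_r; [assumption|]. apply Rabs_le, COS_bound. }
assert (Hf : f (1 / 2) = 0).
{ unfold f. replace (phi_fourier' n (1 / 2)) with 0.
  2:{ unfold phi_fourier'. rewrite (Rsum_ext _ (fun _ => 0)); [rewrite Rsum_const; ring|].
      intros k _. replace (2 * INR (S k) * (PI * (1 / 2))) with (INR (S k) * PI) by field.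
      rewrite sin_INR_PI. unfold Rdiv. ring. }
  replace (M * (1 / 2)) with (PI / 2 - - (INR n * PI)) by (unfold M; field).
  rewrite cos_shift, sin_neg, sin_INR_PI. rewrite Ropp_0. unfold Rdiv. rewrite Rmult_0_r, Rmult_0_l. field. }
assert (Hg : g (1 / 2) <= 0).
{ unfold g. assert (0 <= 2 / (M * sin (PI * (1 / 2)))); [|lra]. apply Rdiv_le_0_compat; [lra|].
  apply Rmult_lt_0_compat; [lra | apply Hsin; lra]. }
rewrite Hf in HI. unfold f in HI. unfold g in HI at 2. specialize (Hsin v ltac:(lra)).
assert (Hms : 0 < M * sin (PI * v)) by (apply Rmult_lt_0_compat; lra).
assert (HC : Rabs (2 * cos (M * v) / (M * sin (PI * v))) <= 2 / (M * sin (PI * v))).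
{ replace (2 * cos (M * v) / (M * sin (PI * v))) with (cos (M * v) * (2 / (M * sin (PI * v)))) by (field; lra).
  assert (0 <= 2 / (M * sin (PI * v))) by (apply Rdiv_le_0_compat; lra).
  rewrite Rabs_mult, (Rabs_right (2 / (M * sin (PI * v)))) by lra.
  rewrite <- (Rmult_1_l (2 / (M * sin (PI * v)))) at 2.
  apply Rmult_le_compat_r; [assumption|]. apply Rabs_le, COS_bound. }
replace (4 / (M * sin (PI * v))) with (2 / (M * sin (PI * v)) + 2 / (M * sin (PI * v))) by (field; lra).
apply Rabs_le_between in HI, HC. apply Rabs_le. lra.
Qed.

Lemma sum_inv_pow_three_halves_le n : Rsum (fun k => sqrt (INR (S k)) / INR (S k) ^ 2) n <= 3.
Proof.
destruct n as [|n]; [simpl; lra|].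
enough (H : Rsum (fun k => sqrt (INR (S k)) / INR (S k) ^ 2) (S n) <= 3 - 2 / sqrt (INR (S n))).
{ assert (0 < 2 / sqrt (INR (S n))); [|lra].
  apply Rdiv_lt_0_compat; [lra|]. apply sqrt_lt_R0, lt_0_INR; lia. }
induction n as [|n IH].
- simpl. rewrite sqrt_1. lra.
- set (m := S n) in *. cbn [Rsum] in *.
  change (Rsum _ m) with (Rsum (fun k => sqrt (INR (S k)) / INR (S k) ^ 2) m) in *.
  assert (Hm : 0 < INR m) by (apply lt_0_INR; lia).
  assert (Hsm : 0 < INR (S m)) by (apply lt_0_INR; lia).
  set (u := sqrt (INR (S m))). assert (Hu : 0 < u) by now apply sqrt_lt_R0.
  assert (Hu2 : u * u = INR m + 1) by (unfold u; rewrite sqrt_sqrt by lra; apply S_INR).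
  assert (Hv : 0 < sqrt (INR m)) by now apply sqrt_lt_R0.
  assert (Hv2 : sqrt (INR m) * sqrt (INR m) = INR m) by (apply sqrt_sqrt; lra).
  set (v := sqrt (INR m)) in *.
  assert (E : INR (S m) = u * u) by (rewrite Hu2; apply S_INR). rewrite E.
  assert (Hd : u / (u * u) ^ 2 <= 2 / v - 2 / u).
  { replace (u / (u * u) ^ 2) with (/ (u * u * u)) by (field; lra).
    assert (Huv : v <= u) by nra.
    replace (2 / v - 2 / u) with (2 * (u * u - v * v) / (u * v * (u + v))) by (field; lra).
    replace (2 * (u * u - v * v)) with 2 by lra.
    assert (H1 : 0 < u * v * (u + v)) by (repeat apply Rmult_lt_0_compat; lra).
    apply (proj1 (Rle_div_r _ _ _ H1)).
    assert (H2 : u * v * (u + v) <= 2 * (u * u * u)).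
    { assert (u * v <= u * u) by nra. assert (0 < u * v) by nra.
      apply Rle_trans with (u * u * (2 * u)); [apply Rmult_le_compat; lra | lra]. }
    apply Rle_trans with (/ (u * u * u) * (2 * (u * u * u))); [|right; field; lra].
    apply Rmult_le_compat_l; [left; apply Rinv_0_lt_compat; repeat apply Rmult_lt_0_compat|]; lra. }
  lra.
Qed.

(** Must be uniform in [n]: the bound [1 - cos z <= z] alone would leave a divergent harmonic sum.
    Since [1 - cos z] is also at most 2, it is at most [sqrt (2 z)], and the sum of [k^(-3/2)]
    converges. *)
Lemma phi_fourier_small n e : 0 < e -> 0 <= phi_fourier n e <= 3 * sqrt e.
Proof.
intros He. pose proof PI_RGT_0 as HPI.
assert (Hden : forall k, 0 < PI ^ 2 * INR (S k) ^ 2).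
{ intros k. apply Rmult_lt_0_compat; apply pow_lt; [lra | apply lt_0_INR; lia]. }
split.
- apply Rsum_nonneg. intros k _. apply Rdiv_le_0_compat; [|apply Hden].
  pose proof (COS_bound (2 * INR (S k) * (PI * e))). lra.
- apply Rle_trans with (sqrt e * Rsum (fun k => sqrt (INR (S k)) / INR (S k) ^ 2) n).
  + rewrite <- Rsum_scal. apply Rsum_le. intros k _.
    assert (Hk : 0 < INR (S k)) by (apply lt_0_INR; lia).
    set (z := 2 * INR (S k) * (PI * e)).
    assert (Hz : 0 <= z) by (unfold z; apply Rmult_le_pos; [|apply Rmult_le_pos]; lra).
    assert (H1 : 1 - cos z <= sqrt (2 * z)).
    { assert (B := COS_bound z). assert (L := one_minus_cos_le z Hz).
      rewrite <- (sqrt_pow2 (1 - cos z)) by lra. apply sqrt_le_1_alt. nra. }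
    assert (H2 : sqrt (2 * z) <= 4 * sqrt e * sqrt (INR (S k))).
    { replace (4 * sqrt e * sqrt (INR (S k))) with (sqrt (16 * (e * INR (S k)))).
      - apply sqrt_le_1_alt. unfold z. pose proof PI_4.
        assert (0 < e * INR (S k)) by (apply Rmult_lt_0_compat; lra). nra.
      - rewrite sqrt_mult, sqrt_mult by nra. replace 16 with (4 ^ 2) by ring.
        rewrite sqrt_pow2 by lra. ring. }
    assert (HP9 : 9 <= PI ^ 2) by (pose proof PI2_3_2; nra).
    replace (sqrt e * (sqrt (INR (S k)) / INR (S k) ^ 2))
      with ((PI ^ 2 * (sqrt e * sqrt (INR (S k)))) / (PI ^ 2 * INR (S k) ^ 2)) by (field; lra).
    apply Rmult_le_compat_r; [left; apply Rinv_0_lt_compat, Hden|].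
    assert (0 <= sqrt e * sqrt (INR (S k))) by (apply Rmult_le_pos; apply sqrt_pos). nra.
  + assert (0 <= sqrt e) by apply sqrt_pos. pose proof (sum_inv_pow_three_halves_le n). nra.
Qed.

Lemma phi_fourier_cauchy n m v : (1 <= n)%nat -> Rabs (phi_fourier (n + m) v - phi_fourier n v) <= / INR n.
Proof.
intros Hn. unfold phi_fourier. rewrite Rsum_add.
match goal with |- Rabs (?a + ?b - ?a) <= _ => replace (a + b - a) with b by ring end.
assert (Hn0 : 0 < INR n) by (apply lt_0_INR; lia).
apply Rle_trans with (Rsum (fun k => / INR (n + k) - / INR (n + S k)) m).
- apply Rsum_abs_le. intros k _.
  rewrite Nat.add_succ_r. set (q := INR (S (n + k))).
  assert (Hq : INR (n + k) = q - 1) by (unfold q; rewrite S_INR; ring).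
  assert (Hq1 : 1 < q).
  { unfold q. change 1 with (INR 1). apply lt_INR. lia. }
  rewrite Hq. assert (HP9 : 9 <= PI ^ 2) by (pose proof PI2_3_2; nra).
  assert (Hq2 : 0 < q ^ 2) by (apply pow_lt; lra).
  replace (/ (q - 1) - / q) with (/ ((q - 1) * q)) by (field; lra).
  rewrite Rabs_right.
  2:{ apply Rle_ge, Rdiv_le_0_compat; [|nra]. pose proof (COS_bound (2 * q * (PI * v))). lra. }
  apply Rle_trans with (/ q ^ 2).
  + apply Rle_div_l; [nra|]. replace (/ q ^ 2 * (PI ^ 2 * q ^ 2)) with (PI ^ 2) by (field; lra).
    pose proof (COS_bound (2 * q * (PI * v))). lra.
  + apply Rinv_le_contravar; nra.
- pose proof (Rsum_telescope (fun k => / INR (n + k)) m) as H. cbv beta in H. rewrite H, Nat.add_0_r.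
  assert (0 < / INR (n + m)) by (apply Rinv_0_lt_compat, lt_0_INR; lia). lra.
Qed.

Lemma phi_fourier_half n v : (1 <= n)%nat -> 0 <= v <= 1 / 2 ->
  Rabs (v * (1 - v) - phi_fourier n v) <= / INR n.
Proof.
intros Hn Hv. pose proof PI_RGT_0 as HPI.
assert (Hn0 : 0 < INR n) by (apply lt_0_INR; lia).
destruct (Req_dec v 0) as [->|Hv0].
{ replace (phi_fourier n 0) with 0.
  - rewrite Rmult_0_l, Rminus_0_r, Rabs_R0. left; now apply Rinv_0_lt_compat.
  - unfold phi_fourier. rewrite (Rsum_ext _ (fun _ => 0)); [rewrite Rsum_const; ring|].
    intros k _. rewrite !Rmult_0_r, cos_0. unfold Rdiv. ring. }
apply le_epsilon. intros d Hd.
(* Anchor at a small point [e], where both sides are small for every number of terms, then let that number grow. *)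
set (e := Rmin v (Rmin 1 (d ^ 2 / 64))).
assert (Hd2 : 0 < d ^ 2) by (apply pow_lt; lra).
assert (He : 0 < e) by (repeat apply Rmin_glb_lt; lra).
assert (He1 : e <= v) by apply Rmin_l.
assert (He2 : e <= 1) by (eapply Rle_trans; [apply Rmin_r | apply Rmin_l]).
assert (He3 : e <= d ^ 2 / 64) by (eapply Rle_trans; [apply Rmin_r | apply Rmin_r]).
assert (Hse : sqrt e <= d / 8).
{ rewrite <- (sqrt_pow2 (d / 8)) by lra. apply sqrt_le_1_alt. lra. }
assert (Hee : e <= sqrt e).
{ rewrite <- (sqrt_sqrt e) at 1 by lra. assert (sqrt e <= 1) by (rewrite <- sqrt_1; now apply sqrt_le_1_alt).
  pose proof (sqrt_pos e). nra. }
assert (Hsin : 0 < sin (PI * e)) by (apply sin_gt_0; nra).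
destruct (nfloor_ex (16 / (PI * sin (PI * e) * d))) as (m & Hm).
{ apply Rdiv_le_0_compat; [lra|]. apply Rmult_lt_0_compat; [apply Rmult_lt_0_compat|]; lra. }
set (N := (n + m)%nat).
set (K := 4 / ((2 * INR N + 1) * PI * sin (PI * e))).
assert (HN : INR m <= INR N) by (apply le_INR; unfold N; lia).
assert (Hm0 := pos_INR m).
assert (HK : K <= d / 4).
{ unfold K. assert (Hp : 0 < PI * sin (PI * e)) by (apply Rmult_lt_0_compat; lra).
  apply Rle_div_l; [rewrite Rmult_assoc; apply Rmult_lt_0_compat; lra|].
  destruct Hm as [_ Hm]. apply Rlt_div_l in Hm; [|apply Rmult_lt_0_compat; lra].
  assert ((INR m + 1) * (PI * sin (PI * e) * d) <= (2 * INR N + 1) * (PI * sin (PI * e) * d)).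
  { apply Rmult_le_compat_r; [apply Rmult_le_pos|]; lra. }
  lra. }
assert (Hinc : Rabs ((v * (1 - v) - phi_fourier N v) - (e * (1 - e) - phi_fourier N e)) <= K * v - K * e).
{ apply (abs_increment_le (fun v => v * (1 - v) - phi_fourier N v) (fun v => K * v)
    (fun v => 1 - 2 * v - phi_fourier' N v) (fun _ => K)); [exact He1 | | |]; intros w Hw.
  - apply (is_derive_minus (fun v => v * (1 - v))); [auto_derive; [trivial | ring] | apply is_derive_phi_fourier].
  - auto_derive; [trivial | ring].
  - eapply Rle_trans; [apply phi_fourier'_bound; lra|]. unfold K.
    apply Rmult_le_compat_l; [lra|]. apply Rinv_le_contravar.
    + apply Rmult_lt_0_compat; [apply Rmult_lt_0_compat|]; lra.
    + apply Rmult_le_compat_l; [apply Rmult_le_pos; lra|]. apply sin_incr_1; nra. }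
destruct (phi_fourier_small N e He) as [S1 S2].
assert (HC := phi_fourier_cauchy n m v Hn). fold N in HC.
assert (HK0 : 0 <= K).
{ apply Rdiv_le_0_compat; [lra|]. apply Rmult_lt_0_compat; [apply Rmult_lt_0_compat|]; lra. }
apply Rabs_le_between in Hinc, HC. apply Rabs_le. nra.
Qed.

Lemma cos_shift_INR x k : cos (2 * INR k * PI + x) = cos x.
Proof. replace (2 * INR k * PI + x) with (x + 2 * INR k * PI) by ring. apply cos_period. Qed.

Lemma phi_fourier_uniform n v : (1 <= n)%nat -> 0 <= v -> Rabs (phi v - 2 * phi_fourier n v) <= 2 / INR n.
Proof.
intros Hn Hv.
assert (Hn0 : 0 < INR n) by (apply lt_0_INR; lia).
set (p := frac_part v). assert (Hp : 0 <= p < 1) by apply frac_part_bounds.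
destruct (nfloor_ex v Hv) as (z & Hz).
assert (Ev : v = p + INR z).
{ unfold p, frac_part. rewrite (Int_part_unique (Z.of_nat z)); rewrite <- INR_IZR_INZ; lra. }
assert (E : phi_fourier n v = phi_fourier n p).
{ unfold phi_fourier. apply Rsum_ext. intros k _. do 2 f_equal.
  replace (2 * INR (S k) * (PI * v)) with (2 * INR (S k * z) * PI + 2 * INR (S k) * (PI * p))
    by (rewrite mult_INR, Ev; ring). apply cos_shift_INR. }
assert (H : Rabs (p * (1 - p) - phi_fourier n p) <= / INR n).
{ destruct (Rle_dec p (1 / 2)) as [Hh|Hh]; [apply phi_fourier_half; auto; lra|].
  replace (phi_fourier n p) with (phi_fourier n (1 - p)).
  - replace (p * (1 - p)) with ((1 - p) * (1 - (1 - p))) by ring. apply phi_fourier_half; auto; lra.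
  - unfold phi_fourier. apply Rsum_ext. intros k _. do 2 f_equal.
    rewrite <- (cos_neg (2 * INR (S k) * (PI * p))), <- (cos_shift_INR (- (2 * INR (S k) * (PI * p))) (S k)). f_equal. ring. }
rewrite E. unfold phi. fold p.
replace (2 * p * (1 - p) - 2 * phi_fourier n p) with (2 * (p * (1 - p) - phi_fourier n p)) by ring.
rewrite Rabs_mult, Rabs_right by lra. unfold Rdiv. lra.
Qed.

(** * The sum of [phi] as an integral, and its value *)

Lemma phi_bounds v : 0 <= phi v <= 1 / 2.
Proof. unfold phi. pose proof (frac_part_bounds v). pose proof (pow2_ge_0 (frac_part v - 1 / 2)). nra. Qed.

(** When an integer separates [u] and [v], [phi] vanishes there, and [phi u], [phi v] are at most
    twice the distances [p] and [1 - q] to the nearest integers crossed. *)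
Lemma phi_lipschitz u v : Rabs (phi u - phi v) <= 2 * Rabs (u - v).
Proof.
assert (W : forall u v, v <= u -> Rabs (phi u - phi v) <= 2 * (u - v)).
{ clear u v. intros u v Huv. assert (Hi := Int_part_le _ _ Huv).
  pose proof (frac_part_bounds u) as Hu. pose proof (frac_part_bounds v) as Hv.
  unfold phi. assert (Eu : u = IZR (Int_part u) + frac_part u) by (unfold frac_part; ring).
  assert (Ev : v = IZR (Int_part v) + frac_part v) by (unfold frac_part; ring).
  destruct (Z.eq_dec (Int_part u) (Int_part v)) as [E|E].
  - rewrite E in Eu. set (p := frac_part u) in *. set (q := frac_part v) in *.
    assert (q <= p) by lra.
    replace (2 * p * (1 - p) - 2 * q * (1 - q)) with (2 * ((p - q) * (1 - p - q))) by ring.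
    assert (- (p - q) <= (p - q) * (1 - p - q) <= p - q) by nra. apply Rabs_le. lra.
  - assert (1 <= IZR (Int_part u) - IZR (Int_part v)).
    { rewrite <- minus_IZR. apply IZR_le. apply le_IZR in Hi. lia. }
    set (p := frac_part u) in *. set (q := frac_part v) in *.
    assert (0 <= p * (1 - p) <= p) by nra. assert (0 <= q * (1 - q) <= 1 - q) by nra. apply Rabs_le. lra. }
destruct (Rle_dec v u) as [H|H].
- rewrite (Rabs_right (u - v)) by lra. now apply W.
- rewrite Rabs_minus_sym, (Rabs_minus_sym u v), (Rabs_right (v - u)) by lra. apply W; lra.
Qed.

Lemma phi_le v : 0 <= v -> phi v <= 2 * v.
Proof.
intros Hv. pose proof (phi_lipschitz v 0) as H. rewrite Rminus_0_r, (Rabs_right v) in H by lra.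
replace (phi 0) with 0 in H by (unfold phi; rewrite frac_part_small by lra; ring).
apply Rabs_le_between in H. lra.
Qed.

Lemma continuous_phi v : continuous phi v.
Proof.
apply continuity_pt_filterlim. intros eps Heps. exists (eps / 2). split; [lra|].
intros w [_ Hw]. unfold dist in *; simpl in *; unfold Rdist in *.
eapply Rle_lt_trans; [apply phi_lipschitz|]. lra.
Qed.

Lemma continuous_phi_profile y t : 0 < t -> continuous (fun t => phi (y / t ^ 2)) t.
Proof.
intros Ht. apply (continuous_comp (fun t => y / t ^ 2) phi); [|apply continuous_phi].
apply (ex_derive_continuous (fun t => y / t ^ 2)). auto_derive. nra.
Qed.

Lemma ex_RInt_phi y t0 t1 : 0 < t0 -> t0 <= t1 -> ex_RInt (fun t => phi (y / t ^ 2)) t0 t1.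
Proof.
intros H0 H1. apply (ex_RInt_continuous (V := R_CompleteNormedModule)). intros t Ht.
apply continuous_phi_profile. rewrite Rmin_left in Ht; lra.
Qed.

Lemma RInt_Rsum (f : nat -> R -> R) (a b : R) n :
  (forall k, ex_RInt (f k) a b) ->
  is_RInt (fun t => Rsum (fun k => f k t) n) a b (Rsum (fun k => RInt (f k) a b) n).
Proof.
intros H. induction n as [|n IH]; simpl.
- evar_last; [apply (is_RInt_const (V := R_NormedModule))|]. unfold scal; simpl; unfold mult; simpl. ring.
- apply (is_RInt_plus (V := R_NormedModule)); [exact IH|]. apply (RInt_correct (V := R_CompleteNormedModule)), H.
Qed.

Lemma Rpower_three_halves q : 0 < q -> / Rpower q (3 / 2) = sqrt q / q ^ 2.
Proof.
intros Hq. replace (3 / 2) with (1 + / 2) by field.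
rewrite Rpower_plus, Rpower_1, Rpower_sqrt by assumption.
assert (0 < sqrt q) by now apply sqrt_lt_R0.
assert (E : sqrt q * sqrt q = q) by (apply sqrt_sqrt; lra).
apply (Rmult_eq_reg_l (q * sqrt q)); [|nra]. rewrite Rinv_r by nra.
replace (q * sqrt q * (sqrt q / q ^ 2)) with (sqrt q * sqrt q / q) by (field; lra). rewrite E. field. lra.
Qed.

Lemma ex_series_of_bounded (u : nat -> R) B : (forall n, 0 <= u n) -> (forall n, Rsum u n <= B) -> ex_series u.
Proof.
intros Hu HB. assert (H : ex_finite_lim_seq (sum_n u)).
{ apply ex_finite_lim_seq_incr with B.
  - intros n. rewrite sum_Sn. unfold plus; simpl. specialize (Hu (S n)). lra.
  - intros n. rewrite Rsum_sum_n. apply HB. }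
destruct H as (l & Hl). exists l. exact Hl.
Qed.

Lemma is_lim_Rsum_Series (u : nat -> R) : ex_series u -> is_lim_seq (fun n => Rsum u n) (Series u).
Proof.
intros H. apply Series_correct in H. apply is_lim_seq_incr_1.
apply is_lim_seq_ext with (sum_n u); [apply Rsum_sum_n | exact H].
Qed.

Lemma zeta_three_halves_lim :
  is_lim_seq (fun n => Rsum (fun k => / Rpower (INR (S k)) (3 / 2)) n) (zeta (3 / 2)).
Proof.
assert (Hk : forall k, 0 < INR (S k)) by (intros; apply lt_0_INR; lia).
apply is_lim_Rsum_Series. apply ex_series_of_bounded with 3.
- intros n. left. apply Rinv_0_lt_compat, exp_pos.
- intros n. rewrite (Rsum_ext _ (fun k => sqrt (INR (S k)) / INR (S k) ^ 2));
    [apply sum_inv_pow_three_halves_le | intros; now apply Rpower_three_halves].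
Qed.

Lemma sum_inv_sq_le n : Rsum (fun k => / INR (S k) ^ 2) n <= 3.
Proof.
eapply Rle_trans; [|apply (sum_inv_pow_three_halves_le n)]. apply Rsum_le. intros k _.
assert (1 <= INR (S k)) by (change 1 with (INR 1); apply le_INR; lia).
rewrite <- (Rmult_1_l (/ _)). apply Rmult_le_compat_r.
- left. apply Rinv_0_lt_compat, pow_lt. lra.
- rewrite <- sqrt_1. now apply sqrt_le_1_alt.
Qed.

(** [2 T / n] is the uniform error of the Fourier sum; the other terms add up [osc_integral] with
    weights [2 / (PI k)^2]. The frequency [2 PI k y] produces the main term
    [2 / PI * sqrt y * k^(-3/2)], and its error [3 al / T] costs one power of [k], hence the
    harmonic sum. *)
Lemma phi_integral_truncated y t0 T n : 0 < y -> 0 < t0 -> t0 <= T -> (1 <= n)%nat ->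
  Rabs (RInt (fun t => phi (y / t ^ 2)) t0 T
        - 2 / PI * sqrt y * Rsum (fun k => / Rpower (INR (S k)) (3 / 2)) n)
  <= 2 * T / INR n + 4 * t0 + 4 * y / T * Rsum (fun k => / INR (S k)) n.
Proof.
intros Hy Ht0 HT Hn. pose proof PI_RGT_0 as HPI. pose proof PI2_3_2 as HP3.
assert (Hn0 : 0 < INR n) by (apply lt_0_INR; lia).
assert (Hk : forall k, 0 < INR (S k)) by (intros; apply lt_0_INR; lia).
set (al := fun k => 2 * PI * INR (S k) * y).
assert (Hal : forall k, 0 < al k).
{ intros k. unfold al. specialize (Hk k). apply Rmult_lt_0_compat; [|lra]. apply Rmult_lt_0_compat; lra. }
set (c := fun k => 2 / (PI ^ 2 * INR (S k) ^ 2)).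
assert (Hck : forall k, 0 < PI ^ 2 * INR (S k) ^ 2).
{ intros k. apply Rmult_lt_0_compat; apply pow_lt; [lra | apply Hk]. }
assert (Hc : forall k, 0 < c k) by (intros; apply Rdiv_lt_0_compat; [lra | apply Hck]).
set (J := fun k => RInt (fun t => 1 - cos (al k / t ^ 2)) t0 T).
assert (HF : is_RInt (fun t => 2 * phi_fourier n (y / t ^ 2)) t0 T (Rsum (fun k => c k * J k) n)).
{ apply (is_RInt_ext (fun t => Rsum (fun k => c k * (1 - cos (al k / t ^ 2))) n)).
  - rewrite Rmin_left, Rmax_right by lra. intros t Ht. unfold phi_fourier. rewrite <- Rsum_scal.
    apply Rsum_ext. intros k _. unfold c, al.
    replace (2 * INR (S k) * (PI * (y / t ^ 2))) with (2 * PI * INR (S k) * y / t ^ 2) by (field; lra).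
    field. split; [specialize (Hk k)|]; lra.
  - rewrite (Rsum_ext _ (fun k => RInt (fun t => c k * (1 - cos (al k / t ^ 2))) t0 T)).
    + apply (RInt_Rsum (fun k t => c k * (1 - cos (al k / t ^ 2)))). intros k.
      apply (ex_RInt_scal (V := R_NormedModule) (fun t => 1 - cos (al k / t ^ 2))).
      now apply osc_integral.
    + intros k _. symmetry. apply (RInt_scal (V := R_CompleteNormedModule) (fun t => 1 - cos (al k / t ^ 2))).
      now apply osc_integral. }
assert (H1 : Rabs (RInt (fun t => phi (y / t ^ 2)) t0 T - Rsum (fun k => c k * J k) n) <= 2 * T / INR n).
{ rewrite <- (is_RInt_unique _ _ _ _ HF).
  rewrite <- (RInt_minus (V := R_CompleteNormedModule)); [|now apply ex_RInt_phi | eexists; exact HF].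
  eapply Rle_trans.
  - apply (abs_RInt_le_const _ t0 T (2 / INR n)); [exact HT | |].
    + apply (ex_RInt_minus (V := R_NormedModule)); [now apply ex_RInt_phi | eexists; exact HF].
    + intros t Ht. apply phi_fourier_uniform; [assumption|]. apply Rdiv_le_0_compat; [lra | apply pow_lt; lra].
  - replace (2 * T / INR n) with (T * (2 / INR n)) by (field; lra).
    apply Rmult_le_compat_r; [apply Rdiv_le_0_compat; lra | lra]. }
assert (H2 : Rabs (Rsum (fun k => c k * J k) n - 2 / PI * sqrt y * Rsum (fun k => / Rpower (INR (S k)) (3 / 2)) n)
  <= 4 * t0 + 4 * y / T * Rsum (fun k => / INR (S k)) n).
{ rewrite <- Rsum_scal, <- Rsum_minus.
  apply Rle_trans with (4 * t0 * (2 / PI ^ 2) * Rsum (fun k => / INR (S k) ^ 2) n + 4 * y / T * Rsum (fun k => / INR (S k)) n).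
  - rewrite <- !Rsum_scal, <- Rsum_plus. apply Rsum_abs_le. intros k _.
    replace (2 / PI * sqrt y * / Rpower (INR (S k)) (3 / 2)) with (c k * sqrt (PI * al k / 2)).
    2:{ rewrite Rpower_three_halves by apply Hk. unfold c, al.
        replace (PI * (2 * PI * INR (S k) * y) / 2) with ((PI ^ 2 * INR (S k)) * y) by field.
        specialize (Hk k).
        rewrite (sqrt_mult (PI ^ 2 * INR (S k)) y), (sqrt_mult (PI ^ 2)), sqrt_pow2 by nra.
        field. lra. }
    rewrite <- Rmult_minus_distr_l, Rabs_mult, (Rabs_right (c k)) by (specialize (Hc k); lra).
    destruct (osc_integral (al k) t0 T (Hal k) Ht0 HT) as [_ HO].
    eapply Rle_trans; [apply Rmult_le_compat_l; [left; apply Hc | exact HO]|].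
    specialize (Hk k).
    replace (c k * (4 * t0 + 3 * al k / T))
      with (4 * t0 * (2 / PI ^ 2) * / INR (S k) ^ 2 + 12 / PI * (y / T) * / INR (S k)) by (unfold c, al; field; lra).
    apply Rplus_le_compat_l. apply Rmult_le_compat_r; [left; now apply Rinv_0_lt_compat|].
    replace (4 * y / T) with (4 * (y / T)) by (field; lra).
    apply Rmult_le_compat_r; [apply Rdiv_le_0_compat; lra|]. apply Rle_div_l; lra.
  - apply Rplus_le_compat_r. pose proof (sum_inv_sq_le n).
    assert (0 <= Rsum (fun k => / INR (S k) ^ 2) n).
    { apply Rsum_nonneg. intros k _. left. apply Rinv_0_lt_compat, pow_lt, Hk. }
    assert (2 / PI ^ 2 <= 1 / 3) by (apply Rle_div_l; nra).
    assert (0 < 2 / PI ^ 2) by (apply Rdiv_lt_0_compat; [lra | apply pow_lt; lra]).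
    assert (2 / PI ^ 2 * Rsum (fun k => / INR (S k) ^ 2) n <= 1 / 3 * 3) by (apply Rmult_le_compat; lra).
    rewrite Rmult_assoc. nra. }
apply Rabs_le_between in H1, H2. apply Rabs_le. lra.
Qed.

Lemma is_lim_inv_INR k : is_lim_seq (fun n => k / INR (S n)) 0.
Proof.
apply is_lim_seq_of_inv_bound with (Rabs k). intros n.
assert (0 < INR (S n)) by (apply lt_0_INR; lia).
rewrite Rminus_0_r. unfold Rdiv. rewrite Rabs_mult, (Rabs_right (/ _)); [lra|].
left; now apply Rinv_0_lt_compat.
Qed.

Lemma phi_integral y t0 t1 : 0 < y -> 0 < t0 -> t0 <= t1 ->
  Rabs (RInt (fun t => phi (y / t ^ 2)) t0 t1 - 2 / PI * zeta (3 / 2) * sqrt y) <= 4 * t0 + 2 * y / t1.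
Proof.
intros Hy Ht0 Ht1. set (f := fun t => phi (y / t ^ 2)).
(* The number of terms must outgrow the truncation point [T], while its harmonic sum must stay small
   against [T]. With [s = j + 1], [T = s^2] and [s^4] terms, the errors are [2 / s^2] and, by
   [harmonic_le], [16 y / s]. The part of the integral beyond [t1] is at most [2 y / t1] because
   [phi v <= 2 v]. *)
set (Z := fun j => Rsum (fun k => / Rpower (INR (S k)) (3 / 2)) (S j ^ 4)).
assert (HZ : is_lim_seq Z (zeta (3 / 2))).
{ refine (is_lim_seq_subseq _ _ (fun j => (S j ^ 4)%nat) _ zeta_three_halves_lim).
  apply eventually_subseq. intros j. apply Nat.pow_lt_mono_l; lia. }
assert (HL : is_lim_seq (fun j => Rabs (RInt f t0 t1 - 2 / PI * sqrt y * Z j))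
   (Rabs (RInt f t0 t1 - 2 / PI * zeta (3 / 2) * sqrt y))).
{ apply (is_lim_seq_abs _ (Finite _)). apply is_lim_seq_minus'; [apply is_lim_seq_const|].
  replace (2 / PI * zeta (3 / 2) * sqrt y) with (2 / PI * sqrt y * zeta (3 / 2)) by ring.
  apply is_lim_seq_mult'; [apply is_lim_seq_const | exact HZ]. }
assert (HR : is_lim_seq (fun j => 4 * t0 + 2 * y / t1 + (2 + 16 * y) / INR (S j)) (4 * t0 + 2 * y / t1 + 0)).
{ apply is_lim_seq_plus'; [apply is_lim_seq_const | apply is_lim_inv_INR]. }
rewrite Rplus_0_r in HR.
refine (is_lim_seq_le_loc _ _ (Finite _) (Finite _) _ HL HR).
destruct (nfloor_ex t1 ltac:(lra)) as (N & HN). exists N. intros j Hj.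
set (s := INR (S j)).
assert (Hs : t1 <= s) by (unfold s; rewrite S_INR; apply le_INR in Hj; lra).
assert (Hs1 : 1 <= s) by (unfold s; change 1 with (INR 1); apply le_INR; lia).
assert (HT : t1 <= s ^ 2) by nra.
assert (E4 : INR (S j ^ 4) = s ^ 4) by apply pow_INR.
pose proof (phi_integral_truncated y t0 (s ^ 2) (S j ^ 4) Hy Ht0 ltac:(lra)
  ltac:(apply Nat.neq_0_lt_0, Nat.pow_nonzero; lia)) as H. fold f in H. fold (Z j) in H.
assert (Hh := harmonic_le (S j ^ 4)). rewrite E4, root4_of_pow in Hh by lra. rewrite E4 in H.
assert (Hf01 : ex_RInt f t0 t1) by (apply ex_RInt_phi; lra).
assert (Hf1T : ex_RInt f t1 (s ^ 2)) by (apply ex_RInt_phi; lra).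
pose proof (RInt_Chasles (V := R_CompleteNormedModule) f t0 t1 (s ^ 2) Hf01 Hf1T) as HCh.
change (RInt f t0 t1 + RInt f t1 (s ^ 2) = RInt f t0 (s ^ 2)) in HCh.
assert (HI : is_RInt (fun t => 2 * (y / t ^ 2)) t1 (s ^ 2) (- (2 * y / s ^ 2) - - (2 * y / t1))).
{ apply (is_RInt_derive (fun t => - (2 * y / t))); rewrite Rmin_left, Rmax_right by lra; intros t Ht.
  - auto_derive; [lra|]. field. lra.
  - apply (ex_derive_continuous (fun t => 2 * (y / t ^ 2))). auto_derive. nra. }
assert (Hlo : 0 <= RInt f t1 (s ^ 2)).
{ apply RInt_ge_0; auto. intros t _. apply phi_bounds. }
assert (Hup : RInt f t1 (s ^ 2) <= 2 * y / t1).
{ apply Rle_trans with (RInt (fun t => 2 * (y / t ^ 2)) t1 (s ^ 2)).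
  - apply RInt_le; auto; [eexists; exact HI|]. intros t Ht. apply phi_le.
    apply Rdiv_le_0_compat; [lra | apply pow_lt; lra].
  - rewrite (is_RInt_unique _ _ _ _ HI).
    assert (0 <= 2 * y / s ^ 2) by (apply Rdiv_le_0_compat; [lra | apply pow_lt; lra]). lra. }
assert (Hb1 : 2 * s ^ 2 / s ^ 4 <= 2 / s).
{ replace (2 * s ^ 2 / s ^ 4) with (2 / s * / s) by (field; lra).
  rewrite <- (Rmult_1_r (2 / s)) at 2. apply Rmult_le_compat_l; [apply Rdiv_le_0_compat; lra|].
  rewrite <- Rinv_1. apply Rinv_le_contravar; lra. }
assert (Hb2 : 4 * y / s ^ 2 * Rsum (fun k => / INR (S k)) (S j ^ 4) <= 16 * y / s).
{ replace (16 * y / s) with (4 * y / s ^ 2 * (4 * s)) by (field; lra).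
  apply Rmult_le_compat_l; [apply Rdiv_le_0_compat; [lra | apply pow_lt; lra] | exact Hh]. }
replace ((2 + 16 * y) / s) with (2 / s + 16 * y / s) by (field; lra).
apply Rabs_le_between in H. apply Rabs_le. lra.
Qed.

(** With [m = N + k], the gap is [y / ((m + a) (m + b))]. It and every [y / t^2] with [t] in
    [[m, m + 1]] lie between [y / (m + r)^2] and [y / m^2], since [r] is at least [b] and 1. The
    Lipschitz bound and a telescoping sum of lag [r] finish. *)
Lemma phi_sum_integral x a b (N n r : nat) : 0 < x -> 0 < a -> a < b -> b <= INR r -> (1 <= r)%nat -> (1 <= N)%nat ->
  Rabs (Rsum (fun k => phi (x / (INR (N + k) + a) - x / (INR (N + k) + b))) n
        - RInt (fun t => phi ((b - a) * x / t ^ 2)) (INR N) (INR (N + n)))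
  <= 2 * INR r * ((b - a) * x) / INR N ^ 2.
Proof.
intros Hx Ha Hb Hr Hr1 HN. set (y := (b - a) * x). assert (Hy : 0 < y) by (apply Rmult_lt_0_compat; lra).
assert (HN0 : 0 < INR N) by (apply lt_0_INR; lia).
set (f := fun t => phi (y / t ^ 2)).
set (u := fun k => y / INR (N + k) ^ 2).
assert (Hpos : forall k, 0 < INR (N + k)) by (intros; apply lt_0_INR; lia).
assert (HE : RInt f (INR N) (INR (N + n)) = Rsum (fun k => RInt f (INR (N + k)) (INR (N + k) + 1)) n).
{ induction n as [|n IH].
  - rewrite Nat.add_0_r. apply (RInt_point (V := R_CompleteNormedModule)).
  - cbn [Rsum]. rewrite <- IH, Nat.add_succ_r, S_INR. symmetry.
    apply (RInt_Chasles (V := R_CompleteNormedModule)); apply ex_RInt_phi; try lra; auto.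
    apply le_INR; lia. }
rewrite HE, <- Rsum_minus.
apply Rle_trans with (2 * Rsum (fun k => u k - u (k + r)%nat) n).
- rewrite <- Rsum_scal. apply Rsum_abs_le. intros k _. specialize (Hpos k).
  set (m := INR (N + k)) in *.
  assert (Em : m + INR r = INR (N + (k + r))) by (unfold m; rewrite !plus_INR; ring).
  assert (Hr1' : 1 <= INR r) by (change 1 with (INR 1); now apply le_INR).
  set (v := x / (m + a) - x / (m + b)).
  assert (Ev : v = y / ((m + a) * (m + b))) by (unfold v, y; field; lra).
  assert (Hbound : forall z, m ^ 2 <= z <= (m + INR r) ^ 2 -> u (k + r)%nat <= y / z <= u k).
  { intros z Hz. unfold u. rewrite <- Em. fold m. assert (0 < m ^ 2) by (apply pow_lt; lra).
    split; apply Rmult_le_compat_l; try lra; apply Rinv_le_contravar; lra. }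
  assert (Hv := Hbound ((m + a) * (m + b)) ltac:(nra)). rewrite <- Ev in Hv.
  assert (Hex : ex_RInt f m (m + 1)) by (apply ex_RInt_phi; lra).
  replace (phi v) with (RInt (fun _ => phi v) m (m + 1)).
  2:{ rewrite RInt_const. unfold scal; simpl; unfold mult; simpl. ring. }
  pose proof (RInt_minus (V := R_CompleteNormedModule) (fun _ => phi v) f m (m + 1)
    (ex_RInt_const (V := R_NormedModule) _ _ _) Hex) as HM.
  change (RInt (fun t => phi v - f t) m (m + 1) = RInt (fun _ => phi v) m (m + 1) - RInt f m (m + 1)) in HM.
  rewrite <- HM.
  replace (2 * (u k - u (k + r)%nat)) with ((m + 1 - m) * (2 * (u k - u (k + r)%nat))) by ring.
  apply abs_RInt_le_const; [lra | |].
  + apply (ex_RInt_minus (V := R_NormedModule)); [apply ex_RInt_const | exact Hex].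
  + intros t Ht. assert (Ht' := Hbound (t ^ 2) ltac:(nra)).
    eapply Rle_trans; [apply phi_lipschitz|]. apply Rmult_le_compat_l; [lra|]. apply Rabs_le. lra.
- assert (H := Rsum_telescope_lag u r n).
  replace (2 * INR r * y / INR N ^ 2) with (2 * (INR r * u 0%nat)) by (unfold u; rewrite Nat.add_0_r; field; lra).
  apply Rmult_le_compat_l; [lra|]. apply H.
  + intros i. apply Rdiv_le_0_compat; [lra | apply pow_lt, Hpos].
  + intros i. apply Rmult_le_compat_l; [lra|]. apply Rinv_le_contravar; [apply pow_lt, Hpos|].
    apply pow_incr. split; [left; apply Hpos | apply le_INR; lia].
Qed.

(** * The partial sums *)

Lemma pow_le_reg n s t : 0 <= t -> s ^ S n <= t ^ S n -> s <= t.
Proof.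
intros Ht H. apply Rnot_lt_le. intros Hts. apply (Rle_not_lt _ _ H).
clear H. induction n as [|n IH]; [lra|].
change (t * t ^ S n < s * s ^ S n). apply Rmult_le_0_lt_compat; auto. apply pow_le; lra.
Qed.

Lemma Rpower_pow_rational t r (n m : nat) : 0 < t -> r * INR n = INR m -> Rpower t r ^ n = t ^ m.
Proof.
intros Ht E. rewrite <- Rpower_pow by apply exp_pos. rewrite Rpower_mult, E. now apply Rpower_pow.
Qed.

Lemma error_scale_facts x b c E X :
  0 < c -> c < b -> 0 < E -> 0 < X -> X ^ 3 = x -> E ^ 9 = c ^ 2 * x ^ 4 ->
  40 * / c ^ 5 * Rpower (1 + b) (27 / 2) <= x ->
  1 <= X /\ (1 + c) * X <= E /\ (1 + c) * X ^ 6 <= E ^ 5 /\ 1 + b <= E /\ (1 + b) * c * x <= E ^ 3.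
Proof.
intros Hc Hcb HE HX HX3 HE9 Hx.
set (B := 1 + b) in *. assert (HB : 1 <= B) by (unfold B; lra). assert (HcB : 1 + c <= B) by (unfold B; lra).
assert (Hx0 : 0 < x) by (rewrite <- HX3; now apply pow_lt).
assert (Hpow : forall n t, 0 < t -> 0 < t ^ n) by (intros; now apply pow_lt).
assert (Hc5 : 0 < c ^ 5) by auto.
assert (P : B ^ 27 <= x ^ 2 * c ^ 10).
{ assert (Hw : Rpower B (27 / 2) ^ 2 = B ^ 27) by (apply Rpower_pow_rational; simpl; lra).
  assert (Hw0 : 0 < Rpower B (27 / 2)) by apply exp_pos.
  assert (H : Rpower B (27 / 2) <= x * c ^ 5).
  { apply Rle_trans with (40 * Rpower B (27 / 2)); [lra|].
    apply (Rmult_le_compat_r (c ^ 5)) in Hx; [|lra].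
    replace (40 * / c ^ 5 * Rpower B (27 / 2) * c ^ 5) with (40 * Rpower B (27 / 2)) in Hx by (field; lra). exact Hx. }
  rewrite <- Hw. replace (x ^ 2 * c ^ 10) with ((x * c ^ 5) ^ 2) by ring. apply pow_incr; lra. }
assert (Hcn : forall n, c ^ n <= B ^ n) by (intros; apply pow_incr; lra).
assert (HBn : forall m n, (m <= n)%nat -> B ^ m <= B ^ n) by (intros; now apply Rle_pow).
assert (P17 : B ^ 17 <= x ^ 2).
{ apply (Rmult_le_reg_r (c ^ 10)); auto. eapply Rle_trans; [|exact P].
  replace (B ^ 27) with (B ^ 17 * B ^ 10) by ring. apply Rmult_le_compat_l; auto. apply pow_le; lra. }
assert (P18 : B ^ 18 <= c ^ 4 * x ^ 2).
{ apply (Rmult_le_reg_r (c ^ 6)); auto. apply Rle_trans with (B ^ 27); [|lra].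
  apply Rle_trans with (B ^ 18 * B ^ 6); [apply Rmult_le_compat_l; auto; apply pow_le; lra|].
  rewrite <- pow_add. apply HBn. lia. }
assert (P9 : B ^ 9 <= c ^ 2 * x).
{ apply (pow_le_reg 1); [apply Rmult_le_pos; [apply pow_le|]; lra|].
  replace ((B ^ 9) ^ 2) with (B ^ 18) by ring. replace ((c ^ 2 * x) ^ 2) with (c ^ 4 * x ^ 2) by ring. exact P18. }
assert (Hx1 : 1 <= x).
{ apply (pow_le_reg 1); [lra|]. rewrite pow1. eapply Rle_trans; [|exact P17]. now apply pow_R1_Rle. }
assert (HX1 : 1 <= X) by (apply (pow_le_reg 2); [lra|]; rewrite pow1, HX3; exact Hx1).
repeat split.
- exact HX1.
- apply (pow_le_reg 8); [lra|]. rewrite Rpow_mult_distr, HE9.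
  replace (X ^ 9) with (x ^ 3) by (rewrite <- HX3; ring).
  replace (c ^ 2 * x ^ 4) with (c ^ 2 * x * x ^ 3) by ring.
  apply Rmult_le_compat_r; [apply pow_le; lra|]. eapply Rle_trans; [|exact P9]. apply pow_incr; lra.
- apply (pow_le_reg 8); [apply pow_le; lra|].
  replace ((E ^ 5) ^ 9) with ((E ^ 9) ^ 5) by ring. rewrite HE9, Rpow_mult_distr.
  replace ((X ^ 6) ^ 9) with (x ^ 18) by (rewrite <- HX3; ring).
  replace ((c ^ 2 * x ^ 4) ^ 5) with (x ^ 2 * c ^ 10 * x ^ 18) by ring.
  apply Rmult_le_compat_r; [apply pow_le; lra|]. eapply Rle_trans; [|exact P].
  apply Rle_trans with (B ^ 9); [apply pow_incr; lra | apply HBn; lia].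
- apply (pow_le_reg 8); [lra|]. rewrite HE9. replace (c ^ 2 * x ^ 4) with (c ^ 2 * x * x ^ 3) by ring.
  rewrite <- (Rmult_1_r (B ^ 9)). apply Rmult_le_compat; try lra; [apply pow_le; lra|]. now apply pow_R1_Rle.
- apply (pow_le_reg 2); [apply pow_le; lra|].
  replace ((E ^ 3) ^ 3) with (E ^ 9) by ring. rewrite HE9.
  assert (P3 : B ^ 3 * c <= x).
  { apply (pow_le_reg 1); [lra|]. eapply Rle_trans; [|exact P17].
    replace ((B ^ 3 * c) ^ 2) with (B ^ 6 * c ^ 2) by ring.
    apply Rle_trans with (B ^ 6 * B ^ 2); [apply Rmult_le_compat_l; auto; apply pow_le; lra|].
    rewrite <- pow_add. apply HBn. lia. }
  replace ((B * c * x) ^ 3) with (B ^ 3 * c * (c ^ 2 * x ^ 3)) by ring.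
  replace (c ^ 2 * x ^ 4) with (x * (c ^ 2 * x ^ 3)) by ring.
  apply Rmult_le_compat_r; [apply Rmult_le_pos; apply pow_le; lra | exact P3].
Qed.

(** Minimality matters: every dyadic range used starts below [L], as the slope condition of
    [dyadic_error_sum] demands, while the end point still reaches [L]. *)
Lemma least_doubling N L : 0 < N ->
  exists J, L <= 2 ^ J * N /\ forall i, (i < J)%nat -> 2 ^ i * N < L.
Proof.
intros HN.
assert (HK : exists K, L <= 2 ^ K * N).
{ destruct (Pow_x_infinity 2 ltac:(rewrite Rabs_right; lra) (L / N)) as (K & HK).
  exists K. specialize (HK K (le_n _)). rewrite Rabs_right in HK.
  - apply Rge_le in HK. exact (proj1 (Rle_div_l _ _ _ HN) HK).
  - apply Rle_ge, pow_le; lra. }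
destruct HK as (K & HK). revert HK. induction K as [|K IH]; intros HK.
- exists 0%nat. split; [exact HK | intros; lia].
- destruct (Rle_dec L (2 ^ K * N)) as [H|H]; [now apply IH|].
  exists (S K). split; [exact HK|]. intros i Hi. apply Rnot_le_lt in H.
  eapply Rle_lt_trans; [|exact H]. apply Rmult_le_compat_r; [lra|]. apply Rle_pow; [lra | lia].
Qed.

Lemma frac_gap_split x a b n :
  frac_gap x a b n = phi (x / (INR n + a) - x / (INR n + b)) + err x a b n.
Proof. apply abs_frac_diff. Qed.

Lemma frac_gap_bounds x a b n : 0 <= frac_gap x a b n <= 1.
Proof.
unfold frac_gap. pose proof (frac_part_bounds (x / (INR n + a))). pose proof (frac_part_bounds (x / (INR n + b))).
split; [apply Rabs_pos | apply Rabs_le; lra].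
Qed.

Lemma frac_gap_partial_sums x a b c E X :
  0 < a -> a < b -> c = b - a -> 0 < E -> 0 < X -> X ^ 3 = x ->
  1 <= X -> (1 + c) * X <= E -> (1 + c) * X ^ 6 <= E ^ 5 -> 1 + b <= E -> (1 + b) * c * x <= E ^ 3 ->
  exists N, forall n,
    Rabs (Rsum (frac_gap x a b) (N + n) - 2 / PI * zeta (3 / 2) * sqrt (c * x)) <= 300000 * E.
Proof.
intros Ha Hab Ec HE HX HX3 HX1 F1 F2 F3 F4.
assert (Hc : 0 < c) by lra. assert (Hx : 0 < x) by (rewrite <- HX3; now apply pow_lt).
assert (HXE : X <= E) by nra. assert (HcXE : c * X <= E) by nra.
destruct (nfloor_ex (8 * E) ltac:(lra)) as (n0 & Hn0).
set (N0 := S n0). assert (HN0 : 8 * E <= INR N0 <= 9 * E) by (unfold N0; rewrite S_INR; lra).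
(* Large enough that the tail beyond it is [O(E)], and small enough that [27 L <= X^2], the slope
   condition. *)
set (L := (1 + c) * X ^ 3 / (27 * E)).
assert (HL0 : 0 < L).
{ apply Rdiv_lt_0_compat; [apply Rmult_lt_0_compat; [lra | now apply pow_lt] | lra]. }
assert (HLX : 27 * L <= X ^ 2).
{ unfold L. replace (27 * ((1 + c) * X ^ 3 / (27 * E))) with ((1 + c) * X * X ^ 2 / E) by (field; lra).
  apply Rle_div_l; [lra|]. rewrite (Rmult_comm (X ^ 2)). apply Rmult_le_compat_r; [apply pow_le|]; lra. }
destruct (least_doubling (INR N0) L ltac:(lra)) as (J & HJ & HJm).
set (N1 := (2 ^ J * N0)%nat).
assert (HN1 : INR N1 = 2 ^ J * INR N0) by (unfold N1; rewrite mult_INR, pow_INR; reflexivity).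
assert (HN1u : INR N1 <= 9 * E + 2 * L).
{ rewrite HN1. destruct J as [|J]; [cbn [pow]; lra|]. specialize (HJm J ltac:(lia)). cbn [pow]. lra. }
assert (H2J : (1 <= 2 ^ J)%nat) by (apply Nat.neq_0_lt_0, Nat.pow_nonzero; lia).
set (n1 := ((2 ^ J - 1) * N0)%nat).
assert (EN : N1 = (N0 + n1)%nat) by (unfold N1, n1; nia).
rewrite <- HN1 in HJ.
assert (HX2 : 0 < X ^ 2) by now apply pow_lt.
assert (HE2 : 0 < E ^ 2) by now apply pow_lt.
assert (HcX2 : (1 + c) * X ^ 2 <= E ^ 2).
{ replace ((1 + c) * X ^ 2) with ((1 + c) * X * X) by ring. replace (E ^ 2) with (E * E) by ring.
  apply Rmult_le_compat; nra. }
exists N1. intros n.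
assert (B1 : 0 <= Rsum (frac_gap x a b) N0 <= 9 * E).
{ split; [apply Rsum_nonneg; intros; apply frac_gap_bounds|].
  apply Rle_trans with (Rsum (fun _ => 1) N0); [apply Rsum_le; intros; apply frac_gap_bounds|].
  rewrite Rsum_const. lra. }
(* The fourth root is at most [2 E], so the three terms give [2 * 132192 + 1 + 10] times [E]. *)
assert (B2 : Rabs (Rsum (fun k => err x a b (N0 + k)) n1) <= 264400 * E).
{ eapply Rle_trans.
  { apply (dyadic_error_sum x a b X N0 J); try lra; rewrite <- ?Ec; try lra.
    intros i Hi. specialize (HJm i Hi). lra. }
  rewrite <- HN1, <- Ec.
  assert (C1 : root4 (X ^ 3 * INR N1) <= 2 * E).
  { rewrite <- (root4_of_pow (2 * E)) by lra. apply root4_le.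
    assert (HX3p : 0 < X ^ 3) by now apply pow_lt.
    apply Rle_trans with (X ^ 3 * (9 * E + 2 * L)); [apply Rmult_le_compat_l; lra|].
    assert (D1 : X ^ 3 * E <= E ^ 4).
    { replace (E ^ 4) with (E ^ 3 * E) by ring. apply Rmult_le_compat_r; [lra|]. apply pow_incr; lra. }
    assert (D2 : X ^ 3 * (27 * L) <= E ^ 4).
    { unfold L. replace (X ^ 3 * (27 * ((1 + c) * X ^ 3 / (27 * E)))) with ((1 + c) * X ^ 6 / E) by (field; lra).
      apply Rle_div_l; [lra|]. replace (E ^ 4 * E) with (E ^ 5) by ring. exact F2. }
    assert (0 < E ^ 4) by now apply pow_lt.
    replace ((2 * E) ^ 4) with (16 * E ^ 4) by ring. lra. }
  assert (C2 : 2 * c * X ^ 2 / INR N0 * (1 - / 2 ^ J) <= E).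
  { assert (0 < / 2 ^ J) by (apply Rinv_0_lt_compat, pow_lt; lra).
    assert (0 <= 2 * c * X ^ 2 / INR N0) by (apply Rdiv_le_0_compat; [apply Rmult_le_pos|]; lra).
    apply Rle_trans with (2 * c * X ^ 2 / INR N0); [nra|].
    apply Rle_div_l; [lra|]. nra. }
  assert (C3 : INR N1 / X <= 10 * E).
  { apply Rle_div_l; [lra|]. apply Rle_trans with (9 * E + 2 * L); [lra|].
    assert (D : 27 * L <= E * X).
    { unfold L. replace (27 * ((1 + c) * X ^ 3 / (27 * E))) with ((1 + c) * X ^ 2 * X / E) by (field; lra).
      apply Rle_div_l; [lra|]. replace (E * X * E) with (E ^ 2 * X) by ring. apply Rmult_le_compat_r; lra. }
    nra. }
  lra. }
destruct (nfloor_ex b ltac:(lra)) as (r0 & Hr0).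
assert (B3 : Rabs (Rsum (fun k => phi (x / (INR (N0 + k) + a) - x / (INR (N0 + k) + b))) n1
        - RInt (fun t => phi (c * x / t ^ 2)) (INR N0) (INR (N0 + n1))) <= E).
{ rewrite Ec. eapply Rle_trans.
  { apply (phi_sum_integral x a b N0 n1 (S r0)); auto; try (unfold N0; lia). rewrite S_INR; lra. }
  rewrite <- Ec, S_INR. apply Rle_div_l; [apply pow_lt; lra|].
  apply Rle_trans with (2 * E ^ 3).
  - apply Rle_trans with (2 * ((1 + b) * c * x)); [|lra].
    replace (2 * ((1 + b) * c * x)) with (2 * (1 + b) * (c * x)) by ring.
    apply Rmult_le_compat_r; [apply Rmult_le_pos; lra | lra].
  - replace (2 * E ^ 3) with (E * (2 * E ^ 2)) by ring. apply Rmult_le_compat_l; [lra|]. nra. }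
assert (HxL : (1 + c) * x / INR N1 <= 27 * E).
{ apply Rle_div_l; [lra|]. apply Rle_trans with (27 * E * L); [|apply Rmult_le_compat_l; lra].
  right. unfold L. rewrite HX3. field. lra. }
assert (HxN : 0 < x / INR N1) by (apply Rdiv_lt_0_compat; lra).
assert (B4 : Rabs (RInt (fun t => phi (c * x / t ^ 2)) (INR N0) (INR (N0 + n1))
   - 2 / PI * zeta (3 / 2) * sqrt (c * x)) <= 90 * E).
{ rewrite <- EN. eapply Rle_trans.
  { apply phi_integral; [apply Rmult_lt_0_compat; lra | lra | apply le_INR; lia]. }
  assert (2 * (c * x) / INR N1 <= 54 * E); [|lra].
  replace (2 * (c * x) / INR N1) with (2 * (c * (x / INR N1))) by (field; lra).
  replace ((1 + c) * x / INR N1) with ((1 + c) * (x / INR N1)) in HxL by (field; lra). lra. }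
destruct (nfloor_ex c ltac:(lra)) as (s0 & Hs0).
assert (B5 : 0 <= Rsum (fun k => frac_gap x a b (N1 + k)) n <= 54 * E).
{ split; [apply Rsum_nonneg; intros; apply frac_gap_bounds|].
  eapply Rle_trans.
  { apply (frac_gap_tail x a b N1 n (S s0)); try lra. rewrite S_INR. lra. }
  rewrite S_INR. apply Rle_trans with (2 * ((1 + c) * x / INR N1)); [|lra].
  replace (2 * (INR s0 + 1) * x / INR N1) with (2 * (INR s0 + 1) * (x / INR N1)) by (field; lra).
  replace (2 * ((1 + c) * x / INR N1)) with (2 * (1 + c) * (x / INR N1)) by (field; lra).
  apply Rmult_le_compat_r; lra. }
(* The pieces [[0, N0)], [[N0, N1)] and beyond add up to [9 + (264400 + 1 + 90) + 54] times [E]. *)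
rewrite Rsum_add. rewrite EN at 1. rewrite Rsum_add.
rewrite (Rsum_ext (fun i => frac_gap x a b (N0 + i)) _ n1 (fun i _ => frac_gap_split x a b (N0 + i))).
rewrite Rsum_plus.
apply Rabs_le_between in B2, B3, B4. apply Rabs_le. lra.
Qed.

Theorem mainTheorem2 :
  exists K : R, 0 < K /\
    forall x a b c : R,
      0 < a -> a < b -> c = b - a ->
      40 * / c ^ 5 * Rpower (1 + b) (27 / 2) <= x ->
      ex_series (frac_gap x a b) /\
      Rabs (Series (frac_gap x a b) - 2 / PI * zeta (3 / 2) * sqrt (c * x))
        <= K * (Rpower c (2 / 9) * Rpower x (4 / 9)).
Proof.
exists 300000. split; [lra|]. intros x a b c Ha Hab Ec Hx.
assert (Hc : 0 < c) by lra.
assert (Hx0 : 0 < x).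
{ eapply Rlt_le_trans; [|exact Hx]. apply Rmult_lt_0_compat; [|apply exp_pos].
  apply Rmult_lt_0_compat; [lra|]. apply Rinv_0_lt_compat, pow_lt; lra. }
set (E := Rpower c (2 / 9) * Rpower x (4 / 9)).
assert (HE : 0 < E) by (apply Rmult_lt_0_compat; apply exp_pos).
set (X := Rpower x (/ 3)). assert (HX : 0 < X) by apply exp_pos.
assert (HX3 : X ^ 3 = x).
{ unfold X. rewrite (Rpower_pow_rational x (/ 3) 3 1) by (simpl; lra). ring. }
assert (HE9 : E ^ 9 = c ^ 2 * x ^ 4).
{ unfold E. rewrite Rpow_mult_distr.
  rewrite (Rpower_pow_rational c (2 / 9) 9 2), (Rpower_pow_rational x (4 / 9) 9 4) by (simpl; lra). reflexivity. }
destruct (error_scale_facts x b c E X Hc ltac:(lra) HE HX HX3 HE9 Hx) as (F0 & F1 & F2 & F3 & F4).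
destruct (frac_gap_partial_sums x a b c E X Ha Hab Ec HE HX HX3 F0 F1 F2 F3 F4) as (N & HN).
(* The terms are nonnegative, so the bound for partial sums of length at least [N] holds for all
   partial sums and gives convergence. *)
assert (Hex : ex_series (frac_gap x a b)).
{ apply ex_series_of_bounded with (2 / PI * zeta (3 / 2) * sqrt (c * x) + 300000 * E).
  - intros n. apply frac_gap_bounds.
  - intros n. specialize (HN n). apply Rabs_le_between in HN.
    rewrite Nat.add_comm, Rsum_add in HN.
    assert (0 <= Rsum (fun i => frac_gap x a b (n + i)) N) by (apply Rsum_nonneg; intros; apply frac_gap_bounds).
    lra. }
split; [exact Hex|].
assert (HL := is_lim_Rsum_Series _ Hex). apply (is_lim_seq_incr_n _ N) in HL.
refine (is_lim_seq_le
  (fun n => Rabs (Rsum (frac_gap x a b) (n + N) - 2 / PI * zeta (3 / 2) * sqrt (c * x)))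
  (fun _ => 300000 * E) (Finite _) (Finite _) _ _ (is_lim_seq_const _)).
2:{ apply (is_lim_seq_abs _ (Finite _)). apply is_lim_seq_minus'; [exact HL | apply is_lim_seq_const]. }
intros n. rewrite Nat.add_comm. apply HN.
Qed.
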